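(* Let $r\ge 1$ and $t\ge 2$ be integers. There exists an $n_0$ such that for every $rt^2$-graph $H\in\mathcal{J}(r,t)$ with $n\ge n_0$ vertices and at least $\binom{\lfloor n/t\rfloor}{rt}+1$ edges we have $\Delta(H)\ge e(H)/(3t)$. On the other hand, for every $n\ge rt^2$, a thick clique $H_0=\widetilde{K}^{rt^2}_{n,t}$ on $n$ vertices belongs to $\mathcal{J}(r,t)$, has $\binom{\lfloor n/t\rfloor}{rt}$ edges, and satisfies $\Delta(H_0)=\binom{\lfloor n/t\rfloor-1}{rt-1}$.
   Context: A $k$-graph ($k$-uniform hypergraph) is a pair $H=(V,E)$ where $E$ is a set of $k$-element subsets of the finite vertex set $V$. $e(H)=|E|$ is its number of edges; the degree of a vertex is the number of edges containing it; $\Delta(H)$ is the maximum vertex degree. For integers $r\ge1$, $t\ge2$ let $I=\{s\ge 0 : t\mid s \text{ or } s\ge rt(t-1)\}$. The class $\mathcal{J}(r,t)$ consists of all $rt^2$-graphs $H$ that are $I$-intersecting, i.e. $|e\cap f|\in I$ for all edges $e,f$ of $H$. Thick clique $\widetilde{K}^{rt^2}_{n,t}$: partition a set $V$ of $n$ vertices into $\lfloor n/t\rfloor$ subsets of size $t$ (called teams) and fewer than $t$ left-over vertices; the edges are precisely all $rt^2$-subsets of $V$ that are unions of $rt$ teams. *)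

(* Defs.v *)
From mathcomp Require Import all_boot all_order all_algebra.

Set Implicit Arguments.
Unset Strict Implicit.
Unset Printing Implicit Defensive.

(* A hypergraph on the vertex set T is given by its edge set
   E : {set {set T}}; its number of vertices is #|T| and its number of
   edges is #|E|. *)

Definition uniform (T : finType) (k : nat) (E : {set {set T}}) : Prop :=
  forall e, e \in E -> #|e| = k.

Definition vdeg (T : finType) (E : {set {set T}}) (v : T) : nat :=
  #|[set e in E | v \in e]|.

Definition maxdeg (T : finType) (E : {set {set T}}) : nat :=
  \max_(v : T) vdeg E v.

Definition intersecting (T : finType) (L : pred nat) (E : {set {set T}}) :
    Prop :=
  forall e f, e \in E -> f \in E -> L #|e :&: f|.

Definition Iset (r t : nat) : pred nat :=
  fun s => (t %| s) || (r * t * (t - 1) <= s).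

Definition classJ (T : finType) (r t : nat) (E : {set {set T}}) : Prop :=
  uniform (r * t ^ 2) E /\ intersecting (Iset r t) E.

(* P is the set of teams; the left-over vertices are ~: cover P. *)
Definition team_partition (T : finType) (t : nat) (P : {set {set T}}) : Prop :=
  [/\ trivIset P, forall A, A \in P -> #|A| = t, #|P| = #|T| %/ t
    & #|~: cover P| < t].

Definition clique_edge (T : finType) (r t : nat) (P : {set {set T}})
    (e : {set T}) : Prop :=
  #|e| = r * t ^ 2 /\
  exists Q : {set {set T}}, [/\ Q \subset P, #|Q| = r * t & e = cover Q].

(* The thick clique depends on the choice of the teams, so it is rendered as a
   predicate on edge sets. *)
Definition thick_clique (T : finType) (r t : nat) (E : {set {set T}}) : Prop :=
  exists2 P : {set {set T}}, team_partition t P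
    & forall e, e \in E <-> clique_edge r t P e.

(* Main.v *)
Require Import Defs.
From mathcomp Require Import all_boot all_order all_algebra.
From mathcomp Require Import zify.

(** Write q = r t and k = q t, so that H is k-uniform, and call S a kernel when
    H has more than k edges that pairwise meet exactly in S.  A set of at most
    k points misses the petal of one of these edges ([kernel_avoid]); hence
    two kernels, or a kernel and an edge, meet in a set of size in I.

    Call a kernel of size t a team.  Every nonzero element of I is at least t,
    so teams are pairwise disjoint, and every edge contains or misses a given
    team.  If there are p teams, at most C(p,q) edges are unions of teams,
    and p <= n/t.  So among more than C(n/t,q) edges some reach outside the
    teams, and the proof consists in seeing what those edges look like.

    All but O(n^(q-1)) of them contain a focal kernel K of size q(t-1) such
    that K plus any further point of the edge is again a kernel.  This comes
    from a delta-system theorem in the style of Furedi: any k-uniform family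
    contains a positive proportion F of its edges such that all intersections
    of sets e :&: f (e fixed, f another edge of F) are kernels
    ([homogeneous_subfamily]).  If every subset of e with fewer than q points
    lies in another edge of F, the complements e :\: f form a family that no
    fewer than q points can hit, and all unions of which have size at most q or
    divisible by t.  Then ([trace_structure]) either there are q singletons
    among them, and e has a focal kernel, or they contain a partition of e
    in q sets of size t, and e is a union of teams.  Otherwise e owns a set of
    fewer than q points within F, and there are O(n^(q-1)) such edges.

    The edges with focal kernel K form a star.  Its petals fill a set of x_K
    points outside the teams, and the sets belonging to different kernels are
    disjoint, again because of sizes modulo t.  So the star has at most
    C(x_K,q) edges, where the x_K add up to at most a = n - pt, while it has at
    most D = Delta(H) edges since all of them contain K.  By convexity of
    C(x,q) the stars together have at most (a/m) C(m,q) edges, where m is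
    determined by C(m-1,q) < D <= C(m,q).

    It remains to compare numbers.  Let N = floor(n/t) and d = N - p.  If d = 0,
    fewer than t points lie outside the teams, too few for any edge to
    leave them.  If d is positive but bounded, there are O(n^(q-2)) edges that
    leave the teams ([card_outer_small]), whereas at least C(N-1,q-1) of them
    are needed.  If d is large, the O(n^(q-1)) remaining edges are negligible
    against d C(N-1,q-1)/q <= C(N,q) - C(p,q), so the stars force
    C(N-1,q-1) <= (1 + eps) t C(m-1,q-1); as t <= 2^(q-1), m is about N/2 at
    least, and this gives e(H) <= 3tD.

    The statement on thick cliques is a count of subsets of the set of teams. *)

Set Implicit Arguments.
Unset Strict Implicit.
Unset Printing Implicit Defensive.

Import Order.TTheory GRing.Theory Num.Theory.

(** * Finite sets *)

Lemma dvdn_consecutive t n : 1 < t -> t %| n -> t %| n.+1 -> False.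
Proof.
by move=> t1 tn; rewrite -addn1 dvdn_addr // dvdn1 => /eqP tE; rewrite tE in t1.
Qed.

Lemma trivIset_eq (T : finType) (P : {set {set T}}) (A B : {set T}) x :
  trivIset P -> A \in P -> B \in P -> x \in A -> x \in B -> A = B.
Proof. by move=> tP AP BP xA xB; rewrite -(def_pblock tP AP xA) (def_pblock tP BP xB). Qed.

Lemma sub_setDD (T : finType) (V W Y : {set T}) :
  V \subset W -> V :\: (W :\: Y) \subset Y.
Proof.
by rewrite -setD_eq0 => /eqP VW; rewrite setDDr VW set0U subsetIr.
Qed.

(** A transversal that need not be injective, so that the sets may overlap. *)
Lemma exists_reps (T : finType) (Q : {set {set T}}) :
  (forall A, A \in Q -> A != set0) ->
  exists D : {set T}, [/\ #|D| <= #|Q|, D \subset cover Q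
    & forall A, A \in Q -> ~~ [disjoint A & D]].
Proof.
move=> Q0; pose g (A : {set T}) := [pick x in A].
exists [set x | Some x \in g @: Q]; split.
- apply: leq_trans (leq_imset_card g Q).
  rewrite -(card_imset _ (@Some_inj _)); apply: subset_leq_card.
  by apply/subsetP => _ /imsetP[y + ->]; rewrite inE.
- apply/subsetP => x; rewrite inE => /imsetP[A AQ]; rewrite /g.
  by case: pickP => // y yA [->]; apply/bigcupP; exists A.
move=> A AQ; have /set0Pn[x xA] := Q0 A AQ.
case E: (g A) => [y|]; last first.
  by move: E; rewrite /g; case: pickP => // /(_ x); rewrite xA.
have yA : y \in A by move: E; rewrite /g; case: pickP => // z zA [<-].
rewrite -setI_eq0; apply/set0Pn; exists y; rewrite !inE yA /= -E.
exact: imset_f.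
Qed.

Lemma pigeonhole (I C : finType) (A : {set I}) (col : I -> C) (c0 : C) :
  exists c, #|A| <= #|C| * #|[set a in A | col a == c]|.
Proof.
pose F c := #|[set a in A | col a == c]|.
exists [arg max_(c > c0) F c]; case: arg_maxnP => // c _ cmax.
have -> : #|A| = \sum_(c : C) F c.
  rewrite -sum1_card (partition_big col xpredT) //=; apply: eq_bigr => d _.
  by rewrite /F -sum1_card; apply: eq_bigl => a; rewrite inE.
rewrite -sum_nat_const; apply: leq_sum => d _; exact: cmax.
Qed.

(** Each such set is the range of a partial function on j points. *)
Lemma card_small_sets (T : finType) j :
  #|[set D : {set T} | #|D| <= j]| <= #|T|.+1 ^ j.
Proof.
pose g (f : {ffun 'I_j -> option T}) := [set x | Some x \in codom f].
apply: leq_trans (_ : #|g @: [set: {ffun 'I_j -> option T}]| <= _); last first.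
  by apply: leq_trans (leq_imset_card _ _) _; rewrite cardsT card_ffun card_ord card_option.
apply: subset_leq_card; apply/subsetP => D; rewrite inE => Dj.
apply/imsetP; exists [ffun i : 'I_j => nth None (map Some (enum D)) i]; first by rewrite inE.
apply/setP => x; rewrite inE; apply/idP/codomP => [xD|[i]].
  have xi : index x (enum D) < #|D| by rewrite cardE index_mem mem_enum.
  exists (Ordinal (leq_trans xi Dj)); rewrite ffunE /= (nth_map x) -?cardE //.
  by rewrite nth_index // mem_enum.
rewrite ffunE; have [le|lt] := leqP (size (enum D)) i.
  by rewrite nth_default // size_map.
by rewrite (nth_map x) // => -[->]; rewrite -mem_enum mem_nth.
Qed.

Lemma leq_card_bigcup (I T : finType) (A : {set I}) (F : I -> {set T}) b :
  (forall i, i \in A -> #|F i| <= b) -> #|\bigcup_(i in A) F i| <= #|A| * b.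
Proof.
move=> le; rewrite -sum_nat_const.
elim/big_rec2: _ => [|i s B iA sB]; first by rewrite cards0.
by apply: leq_trans (leq_card_setU _ _) _; apply: leq_add; rewrite ?le.
Qed.

Lemma odflt_pickP (I : finType) (P : pred I) d :
  [exists x, P x] -> P (odflt d [pick x | P x]).
Proof. by move=> /existsP[x Px]; case: pickP => [y //|/(_ x)]; rewrite Px. Qed.

(** * Kernels of sunflowers *)

Definition sunflower (T : finType) (G : {set {set T}}) (S : {set T}) : bool :=
  [forall e in G, S \subset e] &&
  [forall e in G, forall f in G, (e != f) ==> (e :&: f == S)].

Definition kernel (T : finType) (s : nat) (H : {set {set T}}) (S : {set T}) :
    bool :=
  [exists G : {set {set T}}, [&& G \subset H, s < #|G| & sunflower G S]].

Section Kernels.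
Variable T : finType.
Implicit Types (e f S X : {set T}) (G H R F : {set {set T}}).

Lemma sunflowerP G S :
  reflect ((forall e, e \in G -> S \subset e) /\
           {in G &, forall e f, e != f -> e :&: f = S})
          (sunflower G S).
Proof.
apply: (iffP andP) => -[sub cap]; split.
- by move=> e eG; apply: (forall_inP sub).
- move=> e f eG fG ef; apply/eqP.
  exact: (implyP (forall_inP (forall_inP cap e eG) f fG)).
- exact/forall_inP.
- by apply/forall_inP => e eG; apply/forall_inP => f fG; apply/implyP => ef;
    apply/eqP; apply: cap.
Qed.

Lemma kernelP s H S :
  reflect (exists G, [/\ G \subset H, s < #|G| & sunflower G S]) (kernel s H S).
Proof.
by apply: (iffP existsP) => -[G]; [case/and3P=> *|case=> *]; exists G => //; apply/and3P.
Qed.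

Lemma kernelS s R H S : R \subset H -> kernel s R S -> kernel s H S.
Proof.
move=> RH /kernelP[G [GR sG sun]]; apply/kernelP; exists G.
by rewrite (subset_trans GR RH).
Qed.

(** The petals e minus S of a sunflower are disjoint, so X meets at most s of them. *)
Lemma kernel_avoid s H S X : kernel s H S -> #|X| <= s ->
  exists2 e, e \in H & S \subset e /\ e :&: X = S :&: X.
Proof.
move=> /kernelP[G [GH sG /sunflowerP[sub cap]]] Xs.
have [/exists_inP[e eG dis]|] := boolP [exists e in G, [disjoint e :\: S & X]].
  exists e; first exact: (subsetP GH).
  split; first exact: sub.
  apply/setP => x; rewrite !inE; case xX: (x \in X); rewrite ?andbF ?andbT //.
  apply/idP/idP; last exact: (subsetP (sub e eG)).
  move=> xe; apply: contraLR xX => xS.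
  by move/disjointFr: dis => -> //; rewrite inE xS.
rewrite negb_exists_in => /forall_inP hit.
have /fin_all_exists[g gP] : forall e : {set T}, exists x : option T, e \in G ->
    exists2 y, x = Some y & y \in (e :\: S) :&: X.
  move=> e; case eG: (e \in G); last by exists None.
  have := hit e eG; rewrite -setI_eq0 => /set0Pn[x xP].
  by exists (Some x) => _; exists x.
have inj : {in G &, injective g}.
  move=> e f eG fG gef; have [//|ef] := eqVneq e f.
  have [y ey] := gP e eG; have [z fz] := gP f fG.
  have <- : y = z by apply: Some_inj; rewrite -ey -fz.
  rewrite !inE => /andP[/andP[yS yf] _] /andP[/andP[_ ye] _].
  by have /setP/(_ y) := cap e f eG fG ef; rewrite !inE ye yf (negPf yS).
have : #|g @: G| <= #|Some @: X|.
  apply: subset_leq_card; apply/subsetP => _ /imsetP[e eG ->].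
  have [y -> yX] := gP e eG; apply/imset_f.
  by move: yX; rewrite inE => /andP[].
rewrite (card_in_imset inj) (card_imset _ (@Some_inj _)).
by move=> GX; have := leq_trans sG (leq_trans GX Xs); rewrite ltnn.
Qed.

Lemma kernel_proper k H S : 0 < k -> uniform k H -> kernel k H S -> #|S| < k.
Proof.
move=> k0 Hk /kernelP[G [GH kG /sunflowerP[sub cap]]].
have /card_gt1P[e [f [eG fG ef]]] : 1 < #|G| by apply: leq_trans kG.
have ek := Hk e (subsetP GH e eG); have fk := Hk f (subsetP GH f fG).
rewrite -ek; apply: proper_card; rewrite properEneq sub // andbT.
apply: contra_neq ef => Se; apply/eqP; rewrite eqEcard ek fk leqnn andbT.
by rewrite -Se sub.
Qed.

(** Take an edge from each sunflower, the first one avoiding S2 and the second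
    one avoiding the first. *)
Lemma kernelI k H S1 S2 : 0 < k -> uniform k H ->
  kernel k H S1 -> kernel k H S2 ->
  exists e1 e2, [/\ e1 \in H, e2 \in H, e1 != e2 & e1 :&: e2 = S1 :&: S2].
Proof.
move=> k0 Hk K1 K2.
have lt1 := kernel_proper k0 Hk K1; have lt2 := kernel_proper k0 Hk K2.
have [e1 e1H [_ E1]] := kernel_avoid K1 (ltnW lt2).
have e1k : #|e1| <= k by rewrite Hk.
have [e2 e2H [_ E2]] := kernel_avoid K2 e1k.
have E : e1 :&: e2 = S1 :&: S2 by rewrite setIC E2 setIC.
exists e1, e2; split => //; apply/eqP => e12.
move: lt1; rewrite -(Hk e1 e1H) -{1}(setIid e1) {2}e12 E ltnNge.
by rewrite subset_leq_card // subsetIl.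
Qed.

(** A maximal sunflower with kernel S has at most k edges, and X is the union of
    its petals. *)
Lemma kernel_hitting_set k R S : uniform k R -> ~~ kernel k R S ->
  exists X : {set T}, [/\ #|X| <= k * k, [disjoint X & S]
    & forall e, e \in R -> S \subset e -> S != e -> ~~ [disjoint X & e]].
Proof.
move=> Rk nker.
pose P (G : {set {set T}}) := (G \subset R) && sunflower G S.
have P0 : P set0.
  by rewrite /P sub0set; apply/sunflowerP; split=> [e|e f]; rewrite inE.
have [G /maxsetP[/andP[GR sun] Gmax] _] := maxset_exists P0.
have /sunflowerP[sub cap] := sun.
exists (cover G :\: S); split.
- apply: leq_trans (subset_leq_card (subsetDl _ _)) _.
  apply: leq_trans (leq_card_cover G) _.
  rewrite (eq_bigr (fun=> k)) => [|e eG]; last by rewrite Rk // (subsetP GR).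
  rewrite sum_nat_const leq_mul2r leqNgt; apply/orP; right.
  by apply: contra nker => kG; apply/kernelP; exists G.
- by rewrite -setI_eq0 setIDAC setDIl setDv setI0.
move=> e eR Se Sne; apply/negP => dis.
have dis' f : f \in G -> e :&: f = S.
  move=> fG; apply/eqP; rewrite eqEsubset.
    apply/andP; split; last by rewrite subsetI Se (sub f fG).
  apply/subsetP => x /setIP[xe xf]; apply: contraLR isT => xS.
  move/pred0P/(_ x): dis; rewrite !inE /= xS xe andbT /=.
  by move/negP; case; apply/bigcupP; exists f.
have eG : e \in G.
  rewrite -(Gmax (e |: G)) ?setU11 ?subsetUr //.
  rewrite /P subUset sub1set eR GR /=; apply/sunflowerP; split.
    by move=> f /setU1P[->|/sub].
  move=> f g /setU1P[->|fG] /setU1P[->|gG]; rewrite ?eqxx // => fg.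
  - exact: dis'.
  - by rewrite setIC dis'.
  - exact: cap.
by move: Sne; rewrite -(dis' e eG) setIid eqxx.
Qed.

End Kernels.

(** * Homogeneous subfamilies *)

Section Homogeneity.
Variable T : finType.
Implicit Types (e f S X : {set T}) (G H R F : {set {set T}}).

Definition rainbow (k : nat) (chi : T -> 'I_k) (R : {set {set T}}) :=
  forall e, e \in R -> {in e &, injective chi}.

(** Overwriting a colouring on e by a fixed bijection makes it rainbow on e, and
    the k colours lost on e, one of k ^ k possibilities, recover it. *)
Lemma many_rainbow_colourings k e : 0 < k -> #|e| = k ->
  #|{ffun T -> 'I_k}| <=
  k ^ k * #|[set chi : {ffun T -> 'I_k} | dinjectiveb chi e]|.
Proof.
move=> k0 ek.
have [x0 x0e] : exists x, x \in e by apply/card_gt0P; rewrite ek.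
have ltk x : x \in e -> index x (enum e) < k.
  by rewrite -ek cardE index_mem mem_enum.
pose rho x : 'I_k := insubd (Ordinal k0) (index x (enum e)).
have rhoE x : x \in e -> rho x = index x (enum e) :> nat.
  by move=> xe; rewrite /rho val_insubd ltk.
pose g (chi : {ffun T -> 'I_k}) :=
  ([ffun i : 'I_k => chi (nth x0 (enum e) i)],
   [ffun x => if x \in e then rho x else chi x]).
have ginj : injective g.
  move=> chi psi [] /ffunP E1 /ffunP E2; apply/ffunP => x.
  have := E2 x; rewrite !ffunE; case: ifP => // xe _.
  have := E1 (Ordinal (ltk x xe)); rewrite !ffunE /=.
  by rewrite nth_index // mem_enum.
rewrite -(card_codom ginj).
set B := [set chi | _].
have <- : #|setX [set: {ffun 'I_k -> 'I_k}] B| = k ^ k * #|B|.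
  by rewrite cardsX cardsT card_ffun card_ord.
apply: subset_leq_card; apply/subsetP => _ /codomP[chi ->].
rewrite !inE /=; apply/dinjectiveP => x y xe ye.
rewrite !ffunE xe ye => /(congr1 val) /=; rewrite !rhoE //.
by move=> E; apply: (@index_inj _ x (enum e)); rewrite ?mem_enum.
Qed.

Lemma rainbow_subfamily k R : 0 < k -> uniform k R ->
  exists chi : T -> 'I_k, exists2 F : {set {set T}}, F \subset R &
    rainbow chi F /\ #|R| <= k ^ k * #|F|.
Proof.
move=> k0 Rk; pose FF := {ffun T -> 'I_k}.
pose F (chi : FF) := [set e in R | dinjectiveb chi e].
pose c0 : FF := [ffun=> Ordinal k0].
pose chi := [arg max_(c > c0) #|F c|].
exists chi, (F chi); first by apply/subsetP => e; rewrite inE => /andP[].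
split; first by move=> e; rewrite inE => /andP[_ /dinjectiveP].
have FF0 : 0 < #|{: FF}| by apply/card_gt0P; exists c0.
rewrite -(leq_pmul2l FF0).
have : \sum_(e in R) #|{: FF}| <= \sum_(e in R) k ^ k * #|[set c : FF | dinjectiveb c e]|.
  by apply: leq_sum => e eR; apply: many_rainbow_colourings => //; apply: Rk.
rewrite sum_nat_const mulnC => /leq_trans; apply.
rewrite -big_distrr /= mulnCA leq_mul2l; apply/orP; right.
have -> : \sum_(e in R) #|[set c : FF | dinjectiveb c e]| = \sum_(c : FF) #|F c|.
  transitivity (\sum_(e in R) \sum_(c : FF | dinjectiveb c e) 1).
    apply: eq_bigr => e _; rewrite -sum1_card; apply: eq_bigl => c; by rewrite inE.
  rewrite (exchange_big_dep predT) //=; apply: eq_bigr => c _.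
  by rewrite -sum1_card; apply: eq_bigl => e; rewrite inE.
rewrite -sum_nat_const; apply: leq_sum => c _.
by rewrite /chi; case: arg_maxnP => // c' _; apply.
Qed.

Definition refine_loss k := ((k * k).+1 ^ (2 ^ k))%N.

(** For a non-kernel S let X S be a small hitting set for the edges around S.
    Give each edge e the table that records, for every S inside e that is not a
    kernel, the rank within X S of some point of e in X S.  If e and f have the
    same table and S = e :&: f is not a kernel, they share a point of X S, which
    is disjoint from S: a contradiction.  A rainbow colouring lets S be named
    independently of e, by its set of colours; so there are boundedly many tables,
    and the most frequent one gives F. *)
Lemma refine_rainbow k (chi : T -> 'I_k) R : uniform k R -> rainbow chi R ->
  exists2 F : {set {set T}}, F \subset R &
    #|R| <= refine_loss k * #|F| /\
    {in F &, forall e f, e != f -> kernel k R (e :&: f)}.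
Proof.
move=> Rk Rchi.
have /fin_all_exists[X XP] : forall S : {set T}, exists X : {set T},
    ~~ kernel k R S -> [/\ #|X| <= k * k, [disjoint X & S]
    & forall e, e \in R -> S \subset e -> S != e -> ~~ [disjoint X & e]].
  move=> S; have [|nk] := boolP (kernel k R S); first by exists set0.
  by have [X XP] := kernel_hitting_set Rk nk; exists X.
(* The part of e with colours in J. *)
pose trace e (J : {set 'I_k}) := [set x in e | chi x \in J].
pose hit e J := if [pick x in X (trace e J) :&: e] is Some x
                then index x (enum (X (trace e J))) else 0.
pose col e : {ffun {set 'I_k} -> 'I_(k * k).+1} := [ffun J => inord (hit e J)].
have [c cP] := pigeonhole R col [ffun=> ord0].
set F := [set e in R | col e == c] in cP.
exists F; first by apply/subsetP => e; rewrite inE => /andP[].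
split.
  by move: cP; rewrite card_ffun card_ord -cardsT -powersetT card_powerset cardsT card_ord.
move=> e f; rewrite !inE => /andP[eR /eqP ec] /andP[fR /eqP fc] ef.
apply: contraT => nk; have [Xk Xdis Xhit] := XP _ nk.
pose J := chi @: (e :&: f).
have trE g : g \in R -> e :&: f \subset g -> trace g J = e :&: f.
  move=> gR sub; apply/setP => x; rewrite inE.
  apply/andP/idP => [[xg /imsetP[y yef xy]]|xef].
    by rewrite (Rchi g gR x y xg (subsetP sub y yef) xy).
  by split; [exact: (subsetP sub) | exact: imset_f].
have ne_of g h : g \in R -> h \in R -> g != h -> g :&: h != g.
  move=> gR hR; apply: contra_neq => gh; apply/eqP.
  by rewrite eqEcard (Rk g gR) (Rk h hR) leqnn andbT -gh subsetIr.
have hitP g : g \in R -> e :&: f \subset g -> e :&: f != g ->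
    exists x, [/\ x \in X (e :&: f), x \in g & index x (enum (X (e :&: f))) = col g J].
  move=> gR sub ne; rewrite ffunE /hit (trE g gR sub).
  case: pickP => [x /setIP[xX xg]|no].
    exists x; split => //; rewrite inordK // ltnS.
    by apply: leq_trans Xk; rewrite cardE ltnW // index_mem mem_enum.
  by case/negP: (Xhit g gR sub ne); rewrite -setI_eq0; apply/eqP/setP => x; rewrite no inE.
have [x [xX xe Ex]] := hitP e eR (subsetIl _ _) (ne_of e f eR fR ef).
have nef : e :&: f != f by rewrite setIC ne_of // eq_sym.
have [y [yX yf Ey]] := hitP f fR (subsetIr _ _) nef.
have xy : x = y.
  apply: (@index_inj _ x (enum (X (e :&: f)))); rewrite ?mem_enum //.
  by apply/eqP; rewrite Ex Ey ec fc.
by move/disjointFr: Xdis => /(_ x xX); rewrite inE xe xy yf.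
Qed.

(** One refinement makes pairwise intersections kernels.  If S and S' are kernels
    of F1 then S :&: S' is the intersection of two edges of F1 ([kernelI]), hence a
    kernel of R; so m refinements control the intersections of m traces e :&: f.
    They are written as e minus a union of sets e :\: f, the form in which they
    are used. *)
Lemma refine_iter k (chi : T -> 'I_k) m R : 0 < k ->
  uniform k R -> rainbow chi R ->
  exists2 F : {set {set T}}, F \subset R &
    #|R| <= refine_loss k ^ m * #|F| /\
    forall e (l : seq {set T}), e \in F ->
      {subset l <= [set e :\: f | f in F :\ e]} -> 0 < size l <= m ->
      kernel k R (e :\: \bigcup_(C <- l) C).
Proof.
move=> k0; elim: m R => [|m IH] R Rk Rchi.
  exists R => //; split; first by rewrite mul1n.
  by move=> e [|C l] //= _ _; rewrite andbF.
have [F1 F1R [cF1 pF1]] := refine_rainbow Rk Rchi.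
have F1k : uniform k F1 by move=> e /(subsetP F1R); apply: Rk.
have F1chi : rainbow chi F1 by move=> e /(subsetP F1R); apply: Rchi.
have [F FF1 [cF pF]] := IH F1 F1k F1chi.
exists F; first exact: subset_trans F1R.
split.
  apply: (leq_trans cF1); rewrite expnS -mulnA leq_mul2l cF orbT //.
move=> e [|C l] // eF sub; rewrite big_cons /= => lm.
have eC : C \in [set e :\: f | f in F :\ e] by apply: sub; rewrite mem_head.
have subl : {subset l <= [set e :\: f | f in F :\ e]}.
  by move=> D Dl; apply: sub; rewrite inE Dl orbT.
case: l => [|D l] in sub subl lm *.
  have /imsetP[f /setD1P[fe fF] ->] := eC.
  rewrite big_nil setU0 setDDr setDv set0U.
  by apply: pF1; rewrite ?(subsetP FF1) // eq_sym.
rewrite setDUr; set l' := D :: l in subl lm *.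
have m0 : 0 < m by move: lm; rewrite /= ltnS => /(leq_trans _) ->.
have K1 : kernel k F1 (e :\: C).
  have := pF e [:: C] eF; rewrite big_cons big_nil setU0; apply => // E.
  by rewrite inE => /eqP ->.
have K2 : kernel k F1 (e :\: \bigcup_(E <- l') E) by apply: pF.
have [g1 [g2 [g1F g2F ne <-]]] := kernelI k0 F1k K1 K2.
exact: pF1.
Qed.

Definition homogeneity_loss k := (k ^ k * refine_loss k ^ (2 ^ k))%N.

(** A set of k points has 2 ^ k subsets, so 2 ^ k refinements reach the
    intersections of any number of traces. *)
Lemma homogeneous_subfamily k R : 0 < k -> uniform k R ->
  exists2 F : {set {set T}}, F \subset R &
    #|R| <= homogeneity_loss k * #|F| /\
    forall e (D : {set {set T}}), e \in F ->
      D \subset [set e :\: f | f in F :\ e] -> D != set0 ->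
      kernel k R (e :\: cover D).
Proof.
move=> k0 Rk.
have [chi [R1 R1R [R1chi cR1]]] := rainbow_subfamily k0 Rk.
have R1k : uniform k R1 by move=> e /(subsetP R1R); apply: Rk.
have [F FR1 [cF pF]] := refine_iter (2 ^ k) k0 R1k R1chi.
exists F; first exact: subset_trans R1R.
split; first by apply: (leq_trans cR1); rewrite -mulnA leq_mul2l cF orbT.
move=> e D eF sub D0; apply: (kernelS R1R).
have -> : cover D = \bigcup_(C <- enum D) C by rewrite /cover big_enum.
apply: pF => //; first by move=> C; rewrite mem_enum; apply: (subsetP sub).
rewrite -cardE card_gt0 D0 /= -(R1k e (subsetP FR1 e eF)) -card_powerset.
apply: subset_leq_card; apply/subsetP => C /(subsetP sub) /imsetP[f _ ->].
by rewrite powersetE subsetDl.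
Qed.

End Homogeneity.

(** * Unions of the complements of kernels *)

(** Here e is an edge and C consists of the sets e :\: f, where f runs through the
    other edges of a homogeneous family.  [C_size] says that intersections of the
    traces e :&: f have sizes in I, and [C_miss] that every set of fewer than q
    points of e lies in another edge. *)
Section Complements.
Variables (T : finType) (q t : nat) (e : {set T}) (C : {set {set T}}).
Implicit Types (A B D V W Y : {set T}).
Hypotheses (t2 : 2 <= t) (q2 : 2 <= q) (tq : t %| q) (card_e : #|e| = q * t).
Hypothesis C_neq0 : forall A, A \in C -> A != set0.
Hypothesis C_sub : forall A, A \in C -> A \subset e.
Hypothesis C_size : forall F : {set {set T}}, F \subset C ->
  (t %| #|cover F|) || (#|cover F| <= q).
Hypothesis C_miss : forall D, #|D| < q -> exists2 A, A \in C & [disjoint A & D].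

Definition union_of B := [exists F : {set {set T}}, (F \subset C) && (B == cover F)].

Lemma union_ofP B :
  reflect (exists2 F : {set {set T}}, F \subset C & B = cover F) (union_of B).
Proof.
apply: (iffP existsP) => [[F /andP[FC /eqP ->]]|[F FC ->]]; exists F => //.
by rewrite FC eqxx.
Qed.

Lemma union_of_mem A : A \in C -> union_of A.
Proof.
move=> AinC; apply/union_ofP; exists [set A]; first by rewrite sub1set.
by rewrite /cover big_set1.
Qed.

Lemma union_ofU A B : union_of A -> union_of B -> union_of (A :|: B).
Proof.
move=> /union_ofP[F FC ->] /union_ofP[G GC ->]; apply/union_ofP.
exists (F :|: G); first by rewrite subUset FC GC.
by rewrite /cover bigcup_setU.
Qed.

Lemma dvd_union B : union_of B -> q <= #|B| -> t %| #|B|.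
Proof.
move=> /union_ofP[F FC ->]; rewrite leq_eqVlt => /orP[/eqP <- //|qB].
by have := C_size FC; rewrite leqNgt qB orbF.
Qed.

Definition avoiding x := cover [set A in C | x \notin A].

Lemma union_of_avoiding x : union_of (avoiding x).
Proof.
apply/union_ofP; exists [set A in C | x \notin A] => //.
by apply/subsetP => A; rewrite inE => /andP[].
Qed.

Lemma sub_avoiding x A : A \in C -> x \notin A -> A \subset avoiding x.
Proof. by move=> AinC xA; apply: (bigcup_sup A); rewrite inE AinC. Qed.

Lemma notin_avoiding x : x \notin avoiding x.
Proof. by apply/negP => /bigcupP[A]; rewrite inE => /andP[_ /negP]. Qed.

Lemma sub1_mem A y : A \in C -> A \subset [set y] -> [set y] \in C.
Proof.
move=> AinC; rewrite subset1 => /orP[/eqP <- //|/eqP A0].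
by have := C_neq0 AinC; rewrite A0 eqxx.
Qed.

Lemma miss_avoiding x W : x \in W -> #|W| < q ->
  exists2 A, A \in C & A \subset avoiding x :\: W.
Proof.
move=> xW Wq; have [A AinC dis] := C_miss Wq; exists A => //.
rewrite subsetD dis andbT sub_avoiding //.
by apply: contraTN xW => xA; rewrite (disjointFr dis xA).
Qed.

(** If z alone is in C, a union B of members that avoids z has fewer than q points:
    otherwise both #|B| and #|z |: B| would be divisible by t.  So the union V of
    all members avoiding z has fewer than q points, and z |: V would be a hitting
    set smaller than q unless it has q points, each of them indispensable. *)
Lemma many_singletons z : [set z] \in C ->
  exists2 Y : {set T}, #|Y| = q & forall y, y \in Y -> [set y] \in C.
Proof.
move=> zC; set V := avoiding z.
have zV : z \notin V := notin_avoiding z.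
have Vq : #|V| < q.
  rewrite ltnNge; apply/negP => qV.
  have tV := dvd_union (union_of_avoiding z) qV.
  have := dvd_union (union_ofU (union_of_mem zC) (union_of_avoiding z)).
  by rewrite cardsU1 zV add1n => /(_ (leqW qV)); apply: dvdn_consecutive.
have Yq : #|z |: V| = q.
  apply/eqP; rewrite eqn_leq cardsU1 zV add1n Vq /= leqNgt; apply/negP => lt.
  have [||A AinC] := @miss_avoiding z (z |: V); first exact: setU11.
    by rewrite cardsU1 zV.
  rewrite (eqP (_ : avoiding z :\: (z |: V) == set0)); last first.
    by rewrite setD_eq0 subsetUr.
  by rewrite subset0; apply/negP/C_neq0.
exists (z |: V) => // y /setU1P[-> //|yV].
have zy : z != y by apply: contraNneq zV => ->.
have [||A AinC sub] := @miss_avoiding z ((z |: V) :\ y).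
- by rewrite in_setD1 zy setU11.
- by rewrite -Yq (cardsD1 y (z |: V)) setU1r // add1n ltnS.
by apply: (sub1_mem AinC); apply: subset_trans sub (sub_setDD _ (subsetUr _ _)).
Qed.

(** Let V be [avoiding x].  If V had fewer than q points, or if some y, z in V did not
    form a member, then x together with V minus one point, or minus y and z, would be
    a hitting set of fewer than q points: a member missed by it would avoid x, hence
    lie in V. *)
Lemma all_pairs x : (forall z, [set z] \notin C) -> #|avoiding x| <= q ->
  #|avoiding x| = q /\
  {in avoiding x &, forall y z, y != z -> [set y; z] \in C}.
Proof.
move=> no1; set V := avoiding x => Vq; have xV : x \notin V := notin_avoiding x.
have miss Y : Y \subset V -> #|V :\: Y|.+1 < q -> exists2 A, A \in C & A \subset Y.
  move=> YV lt; have [||A AinC sub] := @miss_avoiding x (x |: V :\: Y).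
  - exact: setU11.
  - by rewrite cardsU1 in_setD (negPf xV) andbF.
  exists A => //; apply: subset_trans sub _; apply: subset_trans (sub_setDD Y (subxx V)).
  by apply: setDS; apply: subsetUr.
have eqV : #|V| = q.
  apply/eqP; rewrite eqn_leq Vq leqNgt /=; apply/negP => lt.
  have [V0|/set0Pn[y yV]] := eqVneq V set0.
    have [||A AinC] := miss set0; rewrite ?sub0set ?setD0 ?V0 ?cards0 // subset0.
    exact/negP/C_neq0.
  have [||A AinC sub] := miss [set y]; first by rewrite sub1set.
    by move: lt; rewrite (cardsD1 y V) yV.
  by have /negP := no1 y; apply; apply: sub1_mem sub.
split=> // y z yV zV yz; have yzV : [set y; z] \subset V by rewrite subUset !sub1set yV.
have [||A AinC Ayz] := miss [set y; z] => //.
  by rewrite -eqV -(cardsID [set y; z] V) (setIidPr yzV) cards2 yz.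
have in1 w w' : A \subset [set w; w'] -> w \in A.
  move=> sub; apply: contraT => wA; have /negP := no1 w'; case.
  apply: (sub1_mem AinC); apply/subsetP => v vA.
  have /set2P[vw|->] := subsetP sub v vA; last exact: set11.
  by rewrite -vw vA in wA.
suff <- : A = [set y; z] by [].
by apply/eqP; rewrite eqEsubset Ayz subUset !sub1set (in1 y z) ?(in1 z y) // setUC.
Qed.

Definition tiling := exists P : {set {set T}},
  [/\ P \subset C, partition P e, #|P| = q & forall A, A \in P -> #|A| = t].

(** By [all_pairs] C contains all pairs from a set V of q points.  Some member A is
    disjoint from V minus a point y, and it contains x.  Let z be another point of
    V.  If q > 2, then V minus z is a union of pairs, and V :|: A would have one
    point more than its subset without z, both sizes being multiples of t.  So
    q = t = 2, V is a pair, and A is its complement in the 4-set e. *)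
Lemma tiling_of_small_avoiding x : (forall z, [set z] \notin C) ->
  #|avoiding x| <= q -> tiling.
Proof.
move=> no1 Vq; have [{}Vq pairs] := all_pairs no1 Vq.
set V := avoiding x in Vq pairs; have xV : x \notin V := notin_avoiding x.
have big A : A \in C -> x \in A -> q < #|V :|: A|.
  move=> AinC xA; rewrite -Vq; apply: proper_card; rewrite properE subsetUl.
  by apply/subsetPn; exists x => //; rewrite inE xA orbT.
have miss y : y \in V -> exists2 A, A \in C & (x \in A) && [disjoint A & V :\ y].
  move=> yV; have [|A AinC dis] := C_miss (D := V :\ y).
    by rewrite -Vq (cardsD1 y V) yV.
  exists A => //; rewrite dis andbT; apply: contraT => xA.
  have /negP := no1 y; case; apply: (sub1_mem AinC).
  apply: subset_trans (sub_setDD [set y] (subxx V)).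
  by rewrite subsetD dis andbT sub_avoiding.
have [y yV] : exists y, y \in V by apply/card_gt0P; rewrite Vq; lia.
have [z] : exists z, z \in V :\ y.
  by apply/card_gt0P; move: Vq; rewrite (cardsD1 y V) yV; lia.
rewrite !inE => /andP[zy zV].
have [A AinC /andP[xA dis]] := miss y yV.
have zA : z \notin A.
  by apply/negP => zA; move/disjointFr: dis => /(_ z zA); rewrite !inE zy zV.
have uVA : union_of (V :|: A).
  by apply: union_ofU (union_of_mem AinC); exact: union_of_avoiding.
have tVA := dvd_union uVA (ltnW (big A AinC xA)).
have [q3|q3] := ltnP 2 q.
  (* Every point of V :\ z lies in a pair inside V :\ z, since q > 2. *)
  have uVz : union_of (V :\ z).
    apply/union_ofP; exists [set B in C | B \subset V :\ z].
      by apply/subsetP => B; rewrite inE => /andP[].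
    apply/setP => w; apply/idP/bigcupP => [wV|[B]]; last first.
      by rewrite inE => /andP[_ /subsetP sub] /sub.
    have [v] : exists v, v \in V :\ z :\ w.
      apply/card_gt0P; move: q3.
      by rewrite -Vq (cardsD1 z V) zV (cardsD1 w (V :\ z)) wV !add1n !ltnS.
    rewrite in_setD1 => /andP[vw vV]; exists [set w; v]; last by rewrite !inE eqxx.
    rewrite inE subUset !sub1set wV vV andbT.
    move: wV vV; rewrite !in_setD1 => /andP[_ wV] /andP[_ vV].
    by rewrite andbT; apply: pairs => //; rewrite eq_sym.
  have E : #|V :|: A| = #|V :\ z :|: A|.+1.
    rewrite (cardsD1 z (V :|: A)) inE zV /= add1n; congr _.+1; congr #|pred_of_set _|.
    by apply/setP => w; rewrite !inE; case: eqP => [->|//]; rewrite (negPf zA) /=.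
  have := big A AinC xA; rewrite E ltnS => /(dvd_union (union_ofU uVz (union_of_mem AinC))) tVz.
  by rewrite E in tVA; case: (dvdn_consecutive t2 tVz tVA).
have {q3} q_eq : q = 2 by apply/eqP; rewrite eqn_leq q3.
have t_eq : t = 2 by apply/eqP; rewrite eqn_leq t2 andbT -q_eq dvdn_leq // q_eq.
have VE : V = [set y; z].
  apply/esym/eqP; rewrite eqEcard subUset !sub1set yV zV Vq cards2 eq_sym zy.
  by rewrite q_eq.
have VC : V \in C by rewrite VE; apply: pairs; rewrite // eq_sym.
have VAe : V :|: A = e.
  apply/eqP; rewrite eqEcard subUset !C_sub //= card_e q_eq t_eq.
  have gt2 : 2 < #|V :|: A| by rewrite -[X in X < _]q_eq big.
  have even4 n : 2 %| n -> 2 < n -> 4 <= n by case: n => [|[|[|[|n]]]].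
  by apply: even4 gt2; rewrite -t_eq.
have cA : #|A| = 2 + #|V :&: A|.
  have := cardsUI V A; rewrite VAe card_e Vq q_eq t_eq => /eqP.
  by rewrite (_ : 2 * 2 = 2 + 2) // -addnA eqn_add2l => /eqP.
have VA0 : V :&: A = set0.
  have : V :&: A \subset [set y].
    apply/subsetP => w /setIP[]; rewrite VE => /set2P[->|->]; first by rewrite set11.
    by rewrite (negPf zA).
  rewrite subset1 => /orP[/eqP E|/eqP //].
  have := dvd_union (union_of_mem AinC).
  by rewrite cA E cards1 q_eq t_eq => /(_ isT).
have AV : [disjoint V & A] by rewrite -setI_eq0 VA0.
have neVA : V != A by apply: contraNneq xV => ->.
rewrite VA0 cards0 in cA.
exists [set V; A]; split.
- by rewrite subUset !sub1set VC AinC.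
- apply/and3P; split.
  + by rewrite /cover bigcup_setU !big_set1 VAe.
  + apply/trivIsetP => B1 B2; rewrite !inE => /orP[]/eqP-> /orP[]/eqP->; rewrite ?eqxx //.
    by rewrite disjoint_sym.
  + by rewrite !inE negb_or eq_sym (C_neq0 VC) eq_sym (C_neq0 AinC).
- by rewrite cards2 neVA q_eq.
- by move=> B; rewrite !inE t_eq => /orP[]/eqP->; rewrite ?Vq ?q_eq ?cA.
Qed.

(** As B has more than q points, unions of members and B have sizes divisible by t, so
    unions of sets D :\: B do; inclusion-exclusion passes from unions to
    intersections. *)
Lemma dvd_inter_diff B A (l : seq {set T}) : union_of B -> q < #|B| ->
  A \in C -> {subset l <= C} -> t %| #|foldr (@setI T) A l :\: B|.
Proof.
move=> + + AinC; elim: l B => [|D l IH] B uB qB sub /=.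
  have uBA := union_ofU uB (union_of_mem AinC).
  have qBA : q <= #|B :|: A| by rewrite (leq_trans (ltnW qB)) // subset_leq_card // subsetUl.
  have : #|B :|: A| = #|A :\: B| + #|B|.
    by rewrite -(cardsID B (B :|: A)) addnC setDUl setDv set0U setUK.
  have := dvd_union uBA qBA => /[swap] ->; rewrite dvdn_addl //.
  exact: dvd_union (ltnW qB).
have DC : D \in C by apply: sub; rewrite mem_head.
have subl : {subset l <= C} by move=> E El; apply: sub; rewrite inE El orbT.
have h1 := IH B uB qB subl.
have h2 : t %| #|foldr (@setI T) A l :\: (B :|: D)|.
  apply: IH => //; first exact: union_ofU (union_of_mem DC).
  by apply: leq_trans qB _; rewrite subset_leq_card // subsetUl.
(* Both #|I :\: B| and #|I :\: (B :|: D)| are divisible by t, where I is the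
   intersection of A and the sets in l; subtract. *)
have := cardsID D (foldr (@setI T) A l :\: B); rewrite setDDl => E.
by move: h1; rewrite -E dvdn_addl // setIDAC setIC.
Qed.

(** The atoms of the Boolean algebra that C generates on its union. *)
Definition cells := preim_partition (fun x => [set A in C | x \in A]) (cover C).

Lemma cell_saturated B y A : B \in cells -> y \in B -> A \in C -> y \in A ->
  B \subset A.
Proof.
move=> /imsetP[x xU ->]; rewrite inE => /andP[yU /eqP xy] AinC yA.
apply/subsetP => z; rewrite inE xy => /andP[zU /eqP/setP/(_ A)].
by rewrite !inE AinC yA.
Qed.

(** The cell of x is the intersection of the members through x, minus the union of
    those that avoid x. *)
Lemma dvd_cell B : (forall x, x \in cover C -> q < #|avoiding x|) ->
  B \in cells -> t %| #|B|.
Proof.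
move=> large /imsetP[x xU ->]; have /bigcupP[A AinC xA] := xU.
have := @dvd_inter_diff (avoiding x) A (enum [set D in C | x \in D])
  (union_of_avoiding x) (large x xU) AinC.
have sub : {subset enum [set D in C | x \in D] <= C}.
  by move=> D; rewrite mem_enum inE => /andP[].
move=> /(_ sub); congr (t %| #|pred_of_set _|); apply/setP => y; rewrite !inE.
have mem_fold l : (y \in foldr (@setI T) A l) = (y \in A) && all (fun D : {set T} => y \in D) l.
  by elim: l => [|D l IH] /=; rewrite ?andbT // inE IH andbCA.
rewrite mem_fold; apply/idP/idP.
  move=> /and3P[yV yA /allP yall]; apply/andP; split; first by apply/bigcupP; exists A.
  apply/eqP/setP => D; rewrite !inE; case DC: (D \in C) => //=.
  apply/idP/idP => [xD|yD]; first by apply: yall; rewrite mem_enum inE DC.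
  by apply: contraNT yV => xD; apply: (subsetP (sub_avoiding DC xD)).
move=> /andP[yU /eqP xy].
have xyD D : D \in C -> (x \in D) = (y \in D).
  by move=> DC; move/setP/(_ D): xy; rewrite !inE DC.
rewrite -(xyD A AinC) xA /=; apply/andP; split.
  apply/negP => /bigcupP[D]; rewrite inE => /andP[DC] /negP xD yD; apply: xD.
  by rewrite xyD.
by apply/allP => D; rewrite mem_enum inE => /andP[DC xD]; rewrite -xyD.
Qed.

(** A set with one point in every cell hits all of C, so there are at least q
    cells.  Each has at least t points and e has qt: hence there are exactly q of
    them, of size t, and they fill e.  Since no cell can be left out by the
    hitting set, every cell contains a member and therefore is one. *)
Lemma tiling_of_large_avoiding :
  (forall x, x \in cover C -> q < #|avoiding x|) -> tiling.
Proof.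
move=> large; have part := preim_partitionP (fun x => [set A in C | x \in A]) (cover C).
rewrite -/cells in part; have /and3P[/eqP covP trivP P0] := part.
have geP B : B \in cells -> t <= #|B|.
  move=> BP; apply: dvdn_leq; last exact: dvd_cell.
  by rewrite card_gt0; apply: contraNneq P0 => <-.
have Ue : cover C \subset e by apply/bigcupsP => A AinC; apply: C_sub.
have cU : #|cover C| = \sum_(B in cells) #|B| := card_partition part.
have leU : \sum_(B in cells) #|B| <= q * t.
  by rewrite -cU -card_e subset_leq_card.
have lePt : #|cells| * t <= \sum_(B in cells) #|B|.
  by rewrite -sum_nat_const; apply: leq_sum => B; apply: geP.
have leP : #|cells| <= q.
  by rewrite -(leq_pmul2r (_ : 0 < t)); [exact: leq_trans leU | lia].
have miss (Q : {set {set T}}) : Q \subset cells -> #|Q| < q ->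
    exists A B, [/\ A \in C, B \in cells :\: Q, B \subset A
      & A \subset cover (cells :\: Q)].
  move=> QP Qq; have [B BQ|D [DQ _ Dhit]] := @exists_reps _ Q.
    by apply: contraNneq P0 => <-; apply: (subsetP QP).
  have [A AinC dis] := C_miss (leq_ltn_trans DQ Qq).
  have inP y : y \in A -> exists2 B, B \in cells :\: Q & (y \in B) && (B \subset A).
    move=> yA; have : y \in cover cells by rewrite covP; apply/bigcupP; exists A.
    move=> /bigcupP[B BP yB]; have BA := cell_saturated BP yB AinC yA.
    exists B; last by rewrite yB.
    rewrite inE BP andbT; apply/negP => BQ; have /negP := Dhit B BQ; apply.
    exact: disjointWl dis.
  have /set0Pn[y yA] := C_neq0 AinC; have [B BP /andP[yB BA]] := inP y yA.
  exists A, B; split => //; apply/subsetP => z /inP[E EP /andP[zE _]].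
  by apply/bigcupP; exists E.
have geQ : q <= #|cells|.
  rewrite leqNgt; apply/negP => lt.
  by have [A [B []]] := miss cells (subxx _) lt; rewrite setDv inE.
have cP : #|cells| = q by apply/eqP; rewrite eqn_leq leP geQ.
exists cells; split => //.
- apply/subsetP => B BP.
  have [||A [D [AinC]]] := miss (cells :\ B); first exact: subD1set.
    by rewrite -cP (cardsD1 B cells) BP.
  have -> : cells :\: (cells :\ B) = [set B].
    by rewrite setDDr setDv set0U; apply/setIidPr; rewrite sub1set.
  rewrite inE => /eqP -> BA; rewrite /cover big_set1 => AB.
  suff <- : A = B by [].
  by apply/eqP; rewrite eqEsubset AB BA.
- suff <- : cover C = e by [].
  by apply/eqP; rewrite eqEcard Ue card_e cU -cP.
- move=> B BP; apply/eqP; rewrite eqn_leq geP // andbT.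
  have others : #|cells :\ B| * t <= \sum_(D in cells :\ B) #|D|.
    by rewrite -sum_nat_const; apply: leq_sum => D /setD1P[_]; apply: geP.
  move: leU; rewrite (big_setD1 B BP) /= -cP (cardsD1 B cells) BP mulSn.
  by move/(leq_trans (leq_add (leqnn #|B|) others)); rewrite leq_add2r.
Qed.

Lemma trace_structure :
  (exists2 Y : {set T}, #|Y| = q & forall y, y \in Y -> [set y] \in C) \/ tiling.
Proof.
have [/existsP[z zC]|] := boolP [exists z, [set z] \in C].
  by left; apply: many_singletons zC.
rewrite negb_exists => /forallP no1; right.
have [/exists_inP[x xU small]|] := boolP [exists x in cover C, #|avoiding x| <= q].
  exact: tiling_of_small_avoiding small.
rewrite negb_exists_in => /forall_inP large.
apply: tiling_of_large_avoiding => x xU; rewrite ltnNge; exact: large.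
Qed.

End Complements.

(** * Unions of teams and thick cliques *)

Section Teams.
Variables (T : finType) (t : nat) (P : {set {set T}}).
Implicit Types (A B : {set T}) (Q : {set {set T}}).
Hypotheses (t0 : 0 < t) (trivP : trivIset P).
Hypothesis card_team : forall A, A \in P -> #|A| = t.

Lemma sub_cover_teams Q A : Q \subset P -> A \in P ->
  (A \subset cover Q) = (A \in Q).
Proof.
move=> QP AP; apply/idP/idP => [sub|AQ]; last exact: bigcup_sup.
have /card_gt0P[x xA] : 0 < #|A| by rewrite card_team.
have /bigcupP[B BQ xB] := subsetP sub x xA.
by rewrite (trivIset_eq trivP AP (subsetP QP B BQ) xA xB).
Qed.

Lemma card_cover_teams Q : Q \subset P -> #|cover Q| = #|Q| * t.
Proof.
move=> QP; have /eqP <- : trivIset Q := trivIsetS QP trivP.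
by rewrite -sum_nat_const; apply: eq_bigr => A /(subsetP QP); apply: card_team.
Qed.

Lemma cover_inj : {in powerset P &, injective cover}.
Proof.
move=> Q R; rewrite !powersetE => QP RP QR; apply/setP => A.
have [AP|AP] := boolP (A \in P).
  by rewrite -(sub_cover_teams QP AP) QR sub_cover_teams.
have nin (S : {set {set T}}) : S \subset P -> (A \in S) = false.
  by move=> SP; apply: contraNF AP; apply: (subsetP SP).
by rewrite !nin.
Qed.

Lemma coverI (Q R : {set {set T}}) : Q \subset P -> R \subset P ->
  cover Q :&: cover R = cover (Q :&: R).
Proof.
move=> QP RP; apply/setP => x; rewrite inE; apply/andP/bigcupP.
  move=> [/bigcupP[A AQ xA] /bigcupP[B BR xB]]; exists A => //; rewrite inE AQ /=.
  by rewrite (trivIset_eq trivP (subsetP QP A AQ) (subsetP RP B BR) xA xB).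
by move=> [A /setIP[AQ AR] xA]; split; apply/bigcupP; exists A.
Qed.

Definition unions q := cover @: [set Q : {set {set T}} | Q \subset P & #|Q| == q].

Lemma card_unions q : #|unions q| = 'C(#|P|, q).
Proof.
rewrite card_in_imset ?cards_draws // => Q R; rewrite !inE => /andP[QP _] /andP[RP _].
by apply: cover_inj; rewrite powersetE.
Qed.

(** The unions that avoid v are those of the teams other than B; Pascal's rule
    gives the number of the others. *)
Lemma vdeg_unions q v B : B \in P -> v \in B ->
  vdeg (unions q.+1) v = 'C(#|P|.-1, q).
Proof.
move=> BP vB; have cP : #|P| = #|P :\ B|.+1 by rewrite (cardsD1 B P) BP.
have : #|[set e in unions q.+1 | v \in e]| + 'C(#|P|.-1, q.+1) = 'C(#|P|, q.+1).
  rewrite -(card_unions q.+1) -(cardsID [set e : {set T} | v \in e] (unions q.+1)).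
  congr (_ + _); first by apply: eq_card => e; rewrite !inE.
  rewrite cP /= -cards_draws -[LHS](card_in_imset (f := cover)); last first.
    move=> Q R; rewrite !inE => /andP[QP _] /andP[RP _].
    by apply: cover_inj; rewrite powersetE (subset_trans _ (subD1set P B)).
  apply: eq_card => e; rewrite in_setD inE; apply/imsetP/andP.
    move=> [Q]; rewrite inE subsetD1 => /andP[/andP[QP BQ] Qq] ->; split.
      apply: contra BQ => /bigcupP[A AQ vA].
      by rewrite (trivIset_eq trivP BP (subsetP QP A AQ) vB vA).
    by apply/imsetP; exists Q; rewrite // inE QP.
  move=> [ve /imsetP[Q]]; rewrite inE => /andP[QP Qq] eQ; exists Q => //.
  rewrite inE Qq andbT subsetD1 QP; apply: contra ve => BQ.
  by rewrite eQ; apply/bigcupP; exists B.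
by rewrite cP /= binS addnC => /eqP; rewrite eqn_add2l => /eqP.
Qed.

Lemma vdeg_unions_out q v : v \notin cover P -> vdeg (unions q) v = 0.
Proof.
move=> vP; apply/eqP; rewrite cards_eq0; apply/eqP/setP => e; rewrite !inE.
apply/negP => /andP[/imsetP[Q]]; rewrite inE => /andP[QP _] -> /bigcupP[A AQ vA].
by case/negP: vP; apply/bigcupP; exists A; rewrite ?(subsetP QP).
Qed.

End Teams.

Lemma exists_disjoint_blocks (T : finType) (t m : nat) : m * t <= #|T| ->
  exists P : {set {set T}},
    [/\ trivIset P, forall A, A \in P -> #|A| = t & 0 < t -> #|P| = m].
Proof.
elim: m => [|m IH] le.
  exists set0; split; [|by move=> A; rewrite inE|by rewrite cards0].
  by apply/trivIsetP => A B; rewrite inE.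
have [|P [trivP cP P_m]] := IH; first by apply: leq_trans le; rewrite leq_mul2r leqnSn orbT.
have [->|t0] := posnP t.
  exists set0; split; [|by move=> A; rewrite inE|by []].
  by apply/trivIsetP => A B; rewrite inE.
have cov : #|cover P| = m * t by rewrite (card_cover_teams trivP cP) ?P_m.
have : t <= #|~: cover P|.
  by rewrite cardsCs setCK cov leq_subRL ?(leq_trans _ le) ?leq_mul2r ?leqnSn ?orbT // addnC -mulSn.
move=> /card_geqP[s [us ss sub]].
pose B := [set x in s].
have cB : #|B| = t by rewrite cardsE; move/card_uniqP: us => ->.
have BP A : A \in P -> [disjoint A & B].
  move=> AP; rewrite disjoint_sym disjoint_subset; apply/subsetP => x.
  rewrite inE => /sub; rewrite !inE => /negP xP; apply/negP => xA; apply: xP.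
  by apply/bigcupP; exists A.
have B0 : B \notin P.
  apply/negP => /[dup] /cP _ /BP; rewrite -setI_eq0 setIid -cards_eq0 cB.
  by rewrite eqn0Ngt t0.
exists (B |: P); split.
- apply/trivIsetP => A1 A2 /setU1P[->|A1P] /setU1P[->|A2P]; rewrite ?eqxx //.
  + by rewrite disjoint_sym BP.
  + by rewrite BP.
  + by apply: (trivIsetP trivP).
- by move=> A /setU1P[->|/cP].
- by rewrite cardsU1 B0 P_m.
Qed.

Section ThickClique.
Variables (T : finType) (r t : nat).
Hypotheses (r0 : 0 < r) (t2 : 2 <= t) (le_n : r * t ^ 2 <= #|T|).

Lemma thick_clique_exists : exists H0 : {set {set T}}, thick_clique r t H0.
Proof.
have t0 : 0 < t by apply: leq_trans t2.
have [P [trivP cP /(_ t0) P_m]] := exists_disjoint_blocks (leq_divM #|T| t).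
exists (unions P (r * t)); exists P.
  split => //; rewrite cardsCs setCK (card_cover_teams trivP cP) // P_m.
  by rewrite {1}(divn_eq #|T| t) addKn ltn_mod.
move=> e; split.
  move=> /imsetP[Q]; rewrite inE => /andP[QP /eqP Qq] ->; split; last by exists Q.
  by rewrite (card_cover_teams trivP cP) // Qq -mulnA.
by move=> [_ [Q [QP Qq ->]]]; apply/imsetP; exists Q; rewrite // inE QP Qq eqxx.
Qed.

Lemma thick_clique_spec (H0 : {set {set T}}) : thick_clique r t H0 ->
  [/\ classJ r t H0, #|H0| = 'C(#|T| %/ t, r * t)
    & maxdeg H0 = 'C(#|T| %/ t - 1, r * t - 1)].
Proof.
have t0 : 0 < t by apply: leq_trans t2.
move=> [P [trivP cP P_m _] HP].
have -> : H0 = unions P (r * t).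
  apply/setP => e; apply/idP/imsetP => [/HP[_ [Q [QP Qq ->]]]|[Q]].
    by exists Q; rewrite // inE QP Qq eqxx.
  rewrite inE => /andP[QP /eqP Qq] ->; apply/HP; split; last by exists Q.
  by rewrite (card_cover_teams trivP cP) // Qq -mulnA.
split.
- split=> [e|e f] /imsetP[Q]; rewrite inE => /andP[QP /eqP Qq] ->.
    by rewrite (card_cover_teams trivP cP) // Qq -mulnA.
  move=> /imsetP[R]; rewrite inE => /andP[RP _] ->.
  rewrite /Iset (coverI trivP) // (card_cover_teams trivP cP) ?dvdn_mull //.
  by rewrite subIset // QP.
- by rewrite (card_unions t0 trivP cP) P_m.
have q0 : 0 < r * t by rewrite muln_gt0 r0.
have deg v B : B \in P -> v \in B -> vdeg (unions P (r * t)) v = 'C(#|T| %/ t - 1, r * t - 1).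
  move=> BP vB; rewrite -{1}(prednK q0) (vdeg_unions t0 trivP cP _ BP vB) P_m.
  by rewrite !subn1.
apply/eqP; rewrite eqn_leq; apply/andP; split.
  apply/bigmax_leqP => v _; have [/bigcupP[B BP vB]|out] := boolP (v \in cover P).
    by rewrite (deg v B).
  by rewrite vdeg_unions_out.
have [B BP] : exists B, B \in P.
  apply/card_gt0P; rewrite P_m divn_gt0 //; apply: leq_trans le_n.
  by rewrite expnS expn1 mulnA leq_pmull.
have /card_gt0P[v vB] : 0 < #|B| by rewrite cP.
by rewrite -(deg v B) //; apply: leq_bigmax.
Qed.

End ThickClique.

(** * Binomial estimates *)

Lemma ffact_ge x j : j <= x -> (x - j).+1 ^ j <= x ^_ j.
Proof.
elim: j x => [|j IH] [|x] //= le; rewrite ffactSS subSS expnS leq_mul ?IH //.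
by rewrite ltnS leq_subr.
Qed.

Lemma expn_le_bin t n j : 0 < t -> 2 * j.+1 <= n %/ t ->
  n.+1 ^ j <= (2 * t) ^ j * j`! * 'C((n %/ t).-1, j).
Proof.
move=> t0; move def_N: (n %/ t) => N le.
have lt_n : n.+1 <= t * N.+1 by rewrite mulnC -def_N ltn_ceil.
have le_base : n.+1 <= 2 * t * (N.-1 - j).+1.
  apply: (leq_trans lt_n); rewrite [2 * t]mulnC -mulnA leq_mul2l.
  by apply/orP; right; lia.
apply: leq_trans (_ : (2 * t * (N.-1 - j).+1) ^ j <= _).
  by have [->|j0] := posnP j; rewrite ?expn0 ?leq_exp2r.
rewrite expnMn -mulnA leq_mul2l; apply/orP; right.
by rewrite mulnC bin_ffact ffact_ge //; lia.
Qed.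

Lemma bin_ratio a b x y j : a <= b -> b * y <= a * x ->
  b ^ j * 'C(y, j) <= a ^ j * 'C(x, j).
Proof.
move=> ab le; rewrite -(leq_pmul2r (fact_gt0 j)) -!mulnA !bin_ffact.
elim: j x y le => [|j IH] x y le //.
case: y le => [|y] le; first by rewrite ffact0n muln0.
case: x le => [|x] le.
  by move: le; rewrite muln0 leqn0 muln_eq0 orbF => /eqP ->; rewrite exp0n.
rewrite !ffactSS !expnS mulnACA [leqRHS]mulnACA; apply: leq_mul => //; apply: IH.
by move: le; rewrite !mulnS; lia.
Qed.

Lemma bin_unbounded q M : 0 < q -> M <= 'C(M + q, q).
Proof.
case: q => // q _; elim: M => // M IH.
by rewrite addSn binS -addn1 leq_add // bin_gt0 addnS leqW // leq_addl.
Qed.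

(** The inequality between real numbers behind the theorem, with h = e(H),
    D = Delta(H), X = C(N-1,q-1) and Y = C(m,q-1); d is the number of missing teams,
    a the number of points outside the teams, and b the number of scattered edges.
    As a < (d+1) t, the bounds on d X and on b give 19 X < 21 t Y.  If h > 3tD, the
    bounds on q h and q D give 1140 (m+1-q) < 441 (N+1), so that 7 m <= 3 (N-1), and
    the last hypothesis contradicts 19 X < 21 t Y.  The numbers 20 and 100 are chosen
    large enough for the error terms to fit between 3t and the constant 2t that the
    leading terms alone would give. *)
Lemma degree_arith q t n p a d N h b D X Y m : 0 < q -> 0 < t ->
  n = p * t + a -> p + d = N -> N * t <= n -> n < t * N.+1 ->
  20 <= d -> 100 * q <= N -> 20 * (q * b) <= d * X ->
  d * X < a * Y + q * b -> q * h <= p * X + a * Y + q * b ->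
  (m.+1 - q) * Y <= q * D ->
  (7 * m <= 3 * N.-1 -> 21 * (t * Y) <= 19 * X) ->
  h <= 3 * t * D.
Proof.
move=> q0 t0 n_eq pd Ntn ntN d20 qN bX low up degm small.
have d0 : 0 < d by apply: leq_trans d20.
have ad : a <= d.+1 * t.
  move: ntN; rewrite n_eq -pd -[(p + d).+1]addnS mulnDr [p * t]mulnC ltn_add2l [t * _]mulnC.
  exact: ltnW.
have XY : 19 * X < 21 * (t * Y).
  rewrite -(ltn_pmul2l d0).
  have h1 : a * Y <= d.+1 * (t * Y) by rewrite mulnA leq_mul2r ad orbT.
  have h2 : 20 * (d.+1 * (t * Y)) <= 21 * (d * (t * Y)).
    rewrite !mulnA leq_mul2r leq_mul2r; apply/orP; right; apply/orP; right.
    by clear -d20; lia.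
  have e1 : d * (19 * X) = 19 * (d * X) by rewrite mulnCA.
  have e2 : d * (21 * (t * Y)) = 21 * (d * (t * Y)) by rewrite mulnCA.
  rewrite e1 e2; clear -h1 h2 low bX.
  move: (d * X) (a * Y) (d.+1 * (t * Y)) (d * (t * Y)) (q * b) h1 h2 low bX.
  by lia.
have Y0 : 0 < Y by move: XY; case: (Y) => //; rewrite !muln0.
rewrite leqNgt; apply/negP => hD.
have big : 3 * t * ((m.+1 - q) * Y) < q * h.
  apply: leq_ltn_trans (_ : 3 * t * (q * D) < _); first by rewrite leq_mul2l degm orbT.
  by rewrite mulnCA ltn_pmul2l.
have pX : 19 * (p * X) <= 21 * (p * t * Y).
  by rewrite mulnCA -mulnA [21 * _]mulnCA leq_mul2l (ltnW XY) orbT.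
have dX : 19 * (d * X) <= 21 * (d * t * Y).
  by rewrite mulnCA -mulnA [21 * _]mulnCA leq_mul2l (ltnW XY) orbT.
have dtn : d * t * Y <= n * Y.
  by rewrite leq_mul2r (leq_trans _ Ntn) ?orbT // leq_mul2r -pd leq_addl orbT.
have nY : n * Y = p * t * Y + a * Y by rewrite n_eq mulnDl.
have lt1 : 1140 * (t * (m.+1 - q)) * Y < 441 * n * Y.
  have e1 : 1140 * (t * (m.+1 - q)) * Y = 380 * (3 * t * ((m.+1 - q) * Y)).
    by rewrite !mulnA.
  rewrite e1 -[441 * n * Y]mulnA; clear -big pX dX dtn nY up bX.
  move: (3 * t * _) (q * h) (p * X) (p * t * Y) (d * X) (d * t * Y) (n * Y) (a * Y)
    (q * b) big pX dX dtn nY up bX.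
  by lia.
rewrite ltn_pmul2r // in lt1.
have lt2 : 1140 * (m.+1 - q) < 441 * N.+1.
  rewrite -(ltn_pmul2l t0) mulnCA; apply: ltn_trans lt1 _.
  by rewrite [ltnRHS]mulnCA ltn_pmul2l.
have : 21 * (t * Y) <= 19 * X by apply: small; clear -lt2 qN q0; lia.
by rewrite leqNgt XY.
Qed.

(** Take m + 1 minimal with D <= C(m+1,q): the number A of edges in stars is then at
    most a C(m,q-1)/q, while D > C(m,q).  If 7 m <= 3 (N-1), with N = n / t, then
    7^(q-1) C(m,q-1) <= 3^(q-1) C(N-1,q-1); together with t <= 2^(q-1) and
    21 * 6^(q-1) <= 19 * 7^(q-1) this is the last hypothesis of [degree_arith]. *)
Lemma degree_of_gap q t n p a d h A b D : 2 <= q -> 2 <= t -> t <= 2 ^ q.-1 ->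
  n = p * t + a -> p + d = n %/ t -> 20 <= d -> 100 * q <= n %/ t ->
  20 * (q * b) <= d * 'C((n %/ t).-1, q.-1) ->
  'C(n %/ t, q) < h -> h <= 'C(p, q) + A + b -> 0 < D ->
  (forall m, D <= 'C(m, q) -> m * A <= a * 'C(m, q)) ->
  h <= 3 * t * D.
Proof.
move=> q2 t2 tq n_eq.
have q0 : 0 < q by apply: ltnW.
have t0 : 0 < t by apply: ltnW.
have Ntn : n %/ t * t <= n by apply: leq_divM.
have ntN : n < t * (n %/ t).+1 by rewrite mulnC ltn_ceil.
move: (n %/ t) Ntn ntN => N Ntn ntN pd d20 qN bX low up D0 HA.
have [m Dm mmin] : exists2 m, D <= 'C(m.+1, q) & 'C(m, q) < D.
  have ex : exists m, D <= 'C(m, q) by exists (D + q); apply: bin_unbounded.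
  case: (ex_minnP ex) => -[|m] Dm mmin.
    by move: Dm; rewrite leqNgt bin_small // D0.
  by exists m => //; rewrite ltnNge; apply/negP => /mmin; rewrite ltnn.
have diag x : q * 'C(x, q) = x * 'C(x.-1, q.-1).
  by rewrite mul_bin_diag prednK.
have qA : q * A <= a * 'C(m, q.-1).
  rewrite -(leq_pmul2l (ltn0Sn m)) mulnCA.
  apply: leq_trans (_ : q * (a * 'C(m.+1, q)) <= _).
    by rewrite leq_mul2l HA ?orbT.
  by rewrite mulnCA diag mulnCA.
have pX : q * 'C(p, q) <= p * 'C(N.-1, q.-1).
  rewrite diag leq_mul2l; apply/orP; right; apply: leq_bin2l.
  by rewrite -!subn1 leq_sub2r // -pd leq_addr.
have qh : q * h <= q * 'C(p, q) + q * A + q * b by rewrite -!mulnDr leq_mul2l up orbT.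
have qlow : N * 'C(N.-1, q.-1) < q * h by rewrite -diag ltn_pmul2l.
have NX : N * 'C(N.-1, q.-1) = p * 'C(N.-1, q.-1) + d * 'C(N.-1, q.-1).
  by rewrite -mulnDl pd.
apply: (@degree_arith q t n p a d N h b D 'C(N.-1, q.-1) 'C(m, q.-1) m) => //.
- rewrite NX in qlow; rewrite -(ltn_add2l (p * 'C(N.-1, q.-1))).
  apply: leq_trans qlow _; apply: leq_trans qh _; rewrite -addnA.
  by apply: leq_add => //; rewrite leq_add2r.
- by apply: leq_trans qh _; rewrite leq_add2r leq_add.
- have -> : (m.+1 - q) * 'C(m, q.-1) = q * 'C(m, q).
    by rewrite -{1 3 4}(prednK q0) mul_bin_left subSS.
  by rewrite leq_mul2l (ltnW mmin) orbT.
move=> ratio; have := bin_ratio q.-1 (isT : 3 <= 7) ratio.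
move: ('C(N.-1, _)) ('C(m, _)) => X Y XY.
rewrite -(@leq_pmul2l (7 ^ q.-1)) ?expn_gt0 //.
have -> : 7 ^ q.-1 * (21 * (t * Y)) = 21 * t * (7 ^ q.-1 * Y).
  by rewrite mulnCA [7 ^ _ * (t * Y)]mulnCA !mulnA.
apply: leq_trans (_ : 21 * t * (3 ^ q.-1 * X) <= _).
  by rewrite leq_mul2l XY orbT.
rewrite [leqRHS]mulnCA !mulnA leq_mul2r; apply/orP; right.
have h67 j : 0 < j -> 21 * 6 ^ j <= 19 * 7 ^ j.
  case: j => // j _; elim: j => // j IH; rewrite expnS [7 ^ _]expnS.
  by move: (6 ^ _) (7 ^ _) IH => u v; lia.
apply: leq_trans (h67 q.-1 _); last by rewrite -ltnS prednK.
by rewrite -mulnA leq_mul2l (_ : 6 = 2 * 3) // expnMn leq_mul2r tq orbT.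
Qed.

(** C(x,q) / x is nondecreasing in x; if x >= m, use the first bound on h. *)
Lemma bin_chord q x m h : 0 < q -> h <= 'C(m, q) -> h <= 'C(x, q) ->
  m * h <= x * 'C(m, q).
Proof.
move=> q0 hm hx; have [mx|xm] := leqP m x; first exact: leq_mul.
have diag y : q * 'C(y, q) = y * 'C(y.-1, q.-1) by rewrite mul_bin_diag prednK.
apply: leq_trans (_ : m * 'C(x, q) <= _); first by rewrite leq_mul2l hx orbT.
rewrite -(leq_pmul2l q0) mulnCA diag [leqRHS]mulnCA diag mulnCA leq_mul2l.
apply/orP; right; rewrite leq_mul2l; apply/orP; right; apply: leq_bin2l.
by rewrite -!subn1 leq_sub2r // ltnW.
Qed.

(** The constants: (n+1)^(q-1) is at most [bin_loss] times C(N-1,q-1), where N is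
    n / t; from [gap_bound] missing teams on, the scattered edges are negligible; and
    below it, [order_bound] makes the outer edges negligible. *)
Definition bin_loss q t := (2 * t) ^ q.-1 * (q.-1)`!.
Definition gap_bound q t c := maxn 20 (20 * (q * c) * bin_loss q t).
Definition order_bound q t c M :=
  100 * q * t + bin_loss q t * (2 ^ (gap_bound q t c * t) * M).

(** The three cases for the number d of missing teams: at least [gap_bound], zero, and
    in between.  Here i counts inner and o outer edges, A those in stars and b the
    scattered ones. *)
Lemma degree_of_counts q t c M n p a h i o A b D :
  2 <= q -> 2 <= t -> t <= 2 ^ q.-1 -> order_bound q t c M <= n ->
  n = p * t + a -> 'C(n %/ t, q) < h -> h = i + o -> i <= 'C(p, q) ->
  o <= A + b -> b <= c * n.+1 ^ q.-1 ->
  o <= 2 ^ a * (M * n.+1 ^ (q - 2)) -> (a < t -> o = 0) ->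
  0 < D -> (forall m, D <= 'C(m, q) -> m * A <= a * 'C(m, q)) ->
  h <= 3 * t * D.
Proof.
move=> q2 t2 tq le_n n_eq many h_eq i_le o_le b_le o_small o0 D0 HA.
have t0 : 0 < t by apply: ltnW.
have q0 : 0 < q by apply: ltnW.
have qN : 100 * q <= n %/ t.
  by rewrite leq_divRL //; apply: leq_trans le_n; apply: leq_addr.
have nX : n.+1 ^ q.-1 <= bin_loss q t * 'C((n %/ t).-1, q.-1).
  by apply: expn_le_bin => //; rewrite prednK //; apply: leq_trans qN; rewrite leq_mul2r orbT.
have pN : p <= n %/ t by rewrite leq_divRL // n_eq leq_addr.
have [d pd] : exists d, p + d = n %/ t by exists (n %/ t - p); rewrite subnKC.
have [large|small] := leqP (gap_bound q t c) d.
  apply: (degree_of_gap q2 t2 tq n_eq pd _ qN _ many _ D0 HA (b := b)).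
  - by apply: leq_trans large; rewrite leq_max leqnn.
  - apply: leq_trans (_ : gap_bound q t c * 'C((n %/ t).-1, q.-1) <= _); last first.
      by rewrite leq_mul2r large orbT.
    apply: leq_trans (_ : 20 * (q * c) * bin_loss q t * 'C((n %/ t).-1, q.-1) <= _).
      have -> : 20 * (q * c) * bin_loss q t * 'C((n %/ t).-1, q.-1) =
                20 * (q * (c * (bin_loss q t * 'C((n %/ t).-1, q.-1)))) by rewrite !mulnA.
      by rewrite !leq_mul2l (leq_trans b_le) ?orbT // leq_mul2l nX orbT.
    by rewrite leq_mul2r leq_max leqnn !orbT.
  - by rewrite h_eq -addnA leq_add.
have a_le : a < d.+1 * t.
  have := ltn_ceil n t0; rewrite [X in X < _]n_eq -pd -[(p + d).+1]addnS mulnDl ltn_add2l.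
  by [].
have d0 : 0 < d.
  rewrite lt0n; apply/negP => /eqP d0; move: a_le pd; rewrite d0 mul1n addn0 => /o0 oz pN'.
  by move: many; rewrite h_eq oz addn0 -pN' ltnNge i_le.
exfalso; have o_gt : 'C((n %/ t).-1, q.-1) < o.
  have : 'C(p, q) + 'C((n %/ t).-1, q.-1) < 'C(p, q) + o.
    apply: leq_trans (_ : h <= _); last by rewrite h_eq leq_add2r.
    apply: leq_ltn_trans many; rewrite -pd -{3}(prednK q0) -{2}(prednK d0) addnS binS.
    by rewrite prednK // -subn1 -addnBA // subn1 leq_add2r leq_bin2l // leq_addr.
  by rewrite ltn_add2l.
have o_lt : o <= 2 ^ (gap_bound q t c * t) * M * n.+1 ^ (q - 2).
  apply: (leq_trans o_small); rewrite mulnA !leq_mul2r; apply/orP; right.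
  apply/orP; right; rewrite leq_exp2l //; apply: leq_trans (ltnW a_le) _.
  by rewrite leq_mul2r small orbT.
have : n.+1 * n.+1 ^ (q - 2) <= n * n.+1 ^ (q - 2).
  rewrite -expnS (_ : (q - 2).+1 = q.-1); last by rewrite -subSn // subSS subn1.
  apply: (leq_trans nX).
  apply: leq_trans (_ : bin_loss q t * (2 ^ (gap_bound q t c * t) * M) * n.+1 ^ (q - 2) <= _).
    by rewrite -mulnA leq_mul2l (leq_trans (ltnW o_gt) o_lt) orbT.
  by rewrite leq_mul2r (leq_trans (leq_addl _ _) le_n) orbT.
by rewrite leq_pmul2r ?expn_gt0 // ltnn.
Qed.

(** * Teams, stars and the remaining edges of a J(r,t) hypergraph *)

Section Structure.
Variables (T : finType) (r t : nat) (H : {set {set T}}).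
Hypotheses (r0 : 0 < r) (t2 : 2 <= t) (HJ : classJ r t H).
Implicit Types (A B S X K D O : {set T}) (e f : {set T}) (Q : {set {set T}}).

Local Notation q := (r * t).
Local Notation k := (r * t ^ 2).

Let t0 : 0 < t. Proof. exact: ltnW. Qed.
Let q2 : 2 <= q. Proof. by apply: leq_trans t2 _; rewrite leq_pmull. Qed.
Let q0 : 0 < q. Proof. exact: ltnW. Qed.
Let k_eq : k = q * t. Proof. by rewrite -mulnA. Qed.
Let k0 : 0 < k. Proof. by rewrite k_eq muln_gt0 q0. Qed.
Let Hk : uniform k H. Proof. by case: HJ. Qed.
Let HI e f : e \in H -> f \in H -> Iset r t #|e :&: f|.
Proof. by case: HJ => _; apply. Qed.

Lemma Iset_kernelI S X : kernel k H S -> kernel k H X -> Iset r t #|S :&: X|.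
Proof.
by move=> KS KX; have [e [f [eH fH _ <-]]] := kernelI k0 Hk KS KX; apply: HI.
Qed.

Lemma Iset_kernel S : kernel k H S -> Iset r t #|S|.
Proof. by move=> KS; rewrite -(setIid S); apply: Iset_kernelI. Qed.

Lemma Iset_kernel_edge S e : kernel k H S -> e \in H -> Iset r t #|S :&: e|.
Proof.
move=> KS eH; have [|f fH [_ <-]] := kernel_avoid (X := e) KS; last exact: HI.
by rewrite Hk.
Qed.

Lemma Iset_lt s : Iset r t s -> s < t -> s = 0.
Proof.
rewrite /Iset => /orP[ts|ge] lt.
  by apply/eqP; apply: contraTT ts; rewrite -lt0n => s0; rewrite gtnNdvd.
have : t <= r * t * (t - 1).
  by rewrite -{1}[t]muln1 leq_mul // ?leq_pmull // subn_gt0.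
by move/leq_trans/(_ ge); rewrite leqNgt lt.
Qed.

(** The teams are read off from H itself: for a thick clique on many points these
    are its teams. *)
Definition teams := [set A : {set T} | (#|A| == t) && kernel k H A].

Lemma card_teams A : A \in teams -> #|A| = t.
Proof. by rewrite inE => /andP[/eqP]. Qed.

Lemma team_in_or_out A X : A \in teams -> Iset r t #|A :&: X| ->
  A \subset X \/ [disjoint A & X].
Proof.
move=> At IAX; have [lt|ge] := ltnP #|A :&: X| t.
  by right; rewrite -setI_eq0 -cards_eq0 (Iset_lt IAX lt).
left; apply/setIidPl/eqP.
by rewrite eqEcard subsetIl (card_teams At).
Qed.

Lemma trivIset_teams : trivIset teams.
Proof.
apply/trivIsetP => A B At Bt; apply: contraR => ndis.
have KA : kernel k H A by move: At; rewrite inE => /andP[].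
have KB : kernel k H B by move: Bt; rewrite inE => /andP[].
have [sub|dis] := team_in_or_out At (Iset_kernelI KA KB); last by rewrite dis in ndis.
by rewrite eqEcard sub (card_teams At) (card_teams Bt) leqnn.
Qed.

Lemma team_edge A e : A \in teams -> e \in H -> A \subset e \/ [disjoint A & e].
Proof.
move=> At eH; apply: team_in_or_out => //; apply: Iset_kernel_edge => //.
by move: At; rewrite inE => /andP[].
Qed.

Definition teams_of e := [set A in teams | A \subset e].

Lemma teams_of_sub e : teams_of e \subset teams.
Proof. by apply/subsetP => A; rewrite inE => /andP[]. Qed.

Lemma cover_teams_of e : e \in H -> cover (teams_of e) = e :&: cover teams.
Proof.
move=> eH; apply/setP => x; rewrite inE; apply/bigcupP/andP.
  move=> [A]; rewrite inE => /andP[At Ae] xA; split; first exact: (subsetP Ae).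
  by apply/bigcupP; exists A.
move=> [xe /bigcupP[A At xA]]; exists A => //; rewrite inE At /=.
by have [//|/disjointFr/(_ xA)] := team_edge At eH; rewrite xe.
Qed.

Lemma card_outer_part e : e \in H ->
  #|e :&: ~: cover teams| + #|teams_of e| * t = q * t.
Proof.
move=> eH; rewrite -k_eq -(Hk eH) -[RHS](cardsID (cover teams)) addnC; congr (_ + _).
  by rewrite -(card_cover_teams trivIset_teams card_teams) ?teams_of_sub // cover_teams_of.
by rewrite setDE.
Qed.

Definition inner := [set e in H | e \subset cover teams].

Lemma card_inner : #|inner| <= 'C(#|teams|, q).
Proof.
rewrite -(card_unions t0 trivIset_teams card_teams).
apply: subset_leq_card; apply/subsetP => e; rewrite inE => /andP[eH sub].
apply/imsetP; exists (teams_of e); last by rewrite cover_teams_of // (setIidPl sub).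
rewrite inE teams_of_sub /= -(eqn_pmul2r t0) -(card_outer_part eH).
by rewrite -setDE (eqP (_ : e :\: cover teams == set0)) ?cards0 // setD_eq0.
Qed.

(** In the family of all k-sets on many points that contain a fixed set K of q(t-1)
    points, K is a focus of every edge. *)
Definition focus e K := [&& K \subset e, #|K| == q * (t - 1), kernel k H K &
  [forall x in e :\: K, kernel k H (x |: K)]].

Definition scattered := [set e in H | (e \notin inner) && ~~ [exists K, focus e K]].

(** [trace_structure] applied to the sets e :\: f.  Minus q singletons, or minus all but
    one of them, e is a kernel; likewise e minus all but one tile. *)
Lemma inner_or_focused (F : {set {set T}}) e : F \subset H -> e \in F ->
  (forall Q, Q \subset [set e :\: f | f in F :\ e] -> Q != set0 ->
    kernel k H (e :\: cover Q)) ->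
  (forall D, #|D| < q -> exists2 f, f \in F :\ e & D :&: e \subset f) ->
  e \in inner \/ [exists K, focus e K].
Proof.
move=> FH eF Cker shared; have eH := subsetP FH e eF.
pose C := [set e :\: f | f in F :\ e].
have ek : #|e| = q * t by rewrite Hk.
have Csub A : A \in C -> A \subset e by move=> /imsetP[f _ ->]; apply: subsetDl.
have Cn0 A : A \in C -> A != set0.
  move=> /imsetP[f /setD1P[fe fF] ->]; rewrite setD_eq0; apply: contra fe => ef.
  rewrite eq_sym eqEcard ef (Hk eH) (Hk _) ?leqnn //.
  exact: (subsetP FH).
have Csize Q : Q \subset C -> (t %| #|cover Q|) || (#|cover Q| <= q).
  move=> QC; have [->|Qn] := eqVneq Q set0; first by rewrite /cover big_set0 cards0 dvdn0.
  have sub : cover Q \subset e by apply/bigcupsP => A /(subsetP QC); apply: Csub.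
  have := Iset_kernel (Cker Q QC Qn); rewrite /Iset cardsD (setIidPr sub) ek.
  have le : #|cover Q| <= q * t by rewrite -ek subset_leq_card.
  rewrite mulnBr muln1 => /orP[d|ge]; apply/orP.
    by left; rewrite -(dvdn_addr _ d) subnK // dvdn_mull.
  right; have qt : q <= q * t by rewrite leq_pmulr.
  by clear -le ge qt; lia.
have Cmiss D : #|D| < q -> exists2 A, A \in C & [disjoint A & D].
  move=> /shared[f fF sub].
  exists (e :\: f); first exact: imset_f.
  rewrite -setI_eq0; apply/eqP/setP => x; rewrite !inE.
  apply/negP => /andP[/andP[xf xe] xD]; case/negP: xf.
  by apply: (subsetP sub); rewrite inE xD.
have tq : t %| q by apply: dvdn_mull.
have [[Y Yq Y1]|[P [PC part Pq Pt]]] := trace_structure t2 q2 tq ek Cn0 Csub Csize Cmiss.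
  have kerY (Y' : {set T}) : Y' \subset Y -> Y' != set0 -> kernel k H (e :\: Y').
    move=> Y'Y Y'0; have -> : Y' = cover [set [set y] | y in Y'].
      by rewrite cover_imset; apply/setP => x; apply/idP/bigcupP => [xY|[y yY]];
        [exists x; rewrite ?inE | rewrite inE => /eqP ->].
    apply: Cker; last first.
      by have /set0Pn[y yY] := Y'0; apply/set0Pn; exists [set y]; apply: imset_f.
    by apply/subsetP => _ /imsetP[y yY ->]; apply: Y1; apply: (subsetP Y'Y).
  have Ye : Y \subset e.
    by apply/subsetP => y yY; have := Csub _ (Y1 y yY); rewrite sub1set.
  have Y0 : Y != set0 by rewrite -card_gt0 Yq.
  right; apply/existsP; exists (e :\: Y); apply/and4P; split.
  - exact: subsetDl.
  - by rewrite cardsD (setIidPr Ye) ek Yq mulnBr muln1.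
  - exact: kerY.
  apply/forall_inP => x; rewrite setDDr setDv set0U => /setIP[xe xY].
  have -> : x |: e :\: Y = e :\: (Y :\ x).
    by apply/setP => y; rewrite !inE; case: eqP => [->|].
  apply: kerY; first exact: subD1set.
  by rewrite -card_gt0; move: q2; rewrite -Yq (cardsD1 x) xY.
left; rewrite inE eH /=; have /and3P[/eqP <- triv _] := part.
apply/bigcupsP => A AP; apply: bigcup_sup; rewrite inE Pt // eqxx /=.
have -> : A = e :\: cover (P :\ A).
  have /and3P[/eqP covP _ _] := part; apply/setP => x; rewrite inE -covP.
  apply/idP/andP => [xA|[nx /bigcupP[B BP xB]]].
    split; last by apply/bigcupP; exists A.
    apply/negP => /bigcupP[B /setD1P[BA BP] xB].
    by rewrite (trivIset_eq triv AP BP xA xB) eqxx in BA.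
  have [<- //|BA] := eqVneq B A; case/negP: nx.
  by apply/bigcupP; exists B; rewrite // in_setD1 BA.
apply: Cker; first exact: subset_trans (subD1set P A) PC.
by rewrite -card_gt0; move: q2; rewrite -Pq (cardsD1 A) AP.
Qed.

(** In a homogeneous subfamily of the scattered edges, each edge e has a subset of
    fewer than q points that lies in no other edge of the subfamily, by
    [inner_or_focused]; these subsets are distinct. *)
Lemma card_scattered :
  #|scattered| <= homogeneity_loss k * #|T|.+1 ^ q.-1.
Proof.
have scH : scattered \subset H by apply/subsetP => e; rewrite inE => /andP[].
have sck : uniform k scattered by move=> e /(subsetP scH); apply: Hk.
have [F Fsc [cF pF]] := homogeneous_subfamily k0 sck.
apply: (leq_trans cF); rewrite leq_mul2l; apply/orP; right.
apply: leq_trans (card_small_sets T q.-1).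
pose own e D := [&& D \subset e, #|D| < q & [forall f in F :\ e, ~~ (D \subset f)]].
have ownP e : e \in F -> [exists D, own e D].
  move=> eF; apply: contraT; rewrite negb_exists => /forallP no.
  have [Q QC Qn|D Dq|inn|foc] := inner_or_focused (subset_trans Fsc scH) eF.
  - by apply: kernelS (pF e Q eF QC Qn).
  - have := no (D :&: e); rewrite /own subsetIr /=.
    rewrite (leq_ltn_trans (subset_leq_card (subsetIl D e)) Dq) /=.
    by rewrite negb_forall_in => /exists_inP[f fF]; rewrite negbK => sub; exists f.
  - by have := subsetP Fsc e eF; rewrite inE inn andbF.
  - by have := subsetP Fsc e eF; rewrite inE foc !andbF.
pose g e := odflt set0 [pick D | own e D].
have gP e : e \in F -> own e (g e).
  by move=> /ownP; apply: odflt_pickP.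
have ginj : {in F &, injective g}.
  move=> e f eF fF gef; apply/eqP; apply: contraT => ef.
  have /and3P[_ _ /forall_inP no] := gP e eF; have /and3P[sub _ _] := gP f fF.
  by have := no f; rewrite !inE eq_sym ef fF gef sub => /(_ isT).
rewrite -(card_in_imset ginj).
apply: subset_leq_card; apply/subsetP => _ /imsetP[e eF ->].
by have /and3P[_ lt _] := gP e eF; rewrite inE -ltnS prednK.
Qed.

Definition focused := [set e in H | (e \notin inner) && [exists K, focus e K]].
Definition core e := odflt set0 [pick K | focus e K].
Definition star K := [set e in focused | core e == K].
Definition spread K := \bigcup_(e in star K) (e :\: K).

Lemma focus_core e : e \in focused -> focus e (core e).
Proof.
rewrite inE => /and3P[_ _ fK]; exact: odflt_pickP fK.
Qed.

Lemma mem_star K e : e \in star K -> [/\ e \in H & focus e K].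
Proof.
rewrite inE => /andP[ef /eqP <-]; split; last exact: focus_core.
by move: ef; rewrite inE => /andP[].
Qed.

Lemma mem_spread K x : x \in spread K ->
  [/\ kernel k H K, kernel k H (x |: K), x \notin K & #|K| = q * (t - 1)].
Proof.
move=> /bigcupP[e /mem_star[_ /and4P[_ /eqP cK KK /forall_inP Kx]] xe].
by split; rewrite ?Kx //; move: xe; rewrite inE => /andP[].
Qed.

(** A team A through x would have #|A :&: K| and #|A :&: (x |: K)| = #|A :&: K|.+1
    both in I, which has no two consecutive elements up to t. *)
Lemma spread_outside K : spread K \subset ~: cover teams.
Proof.
apply/subsetP => x /mem_spread[KK KxK xK _]; rewrite inE; apply/negP => /bigcupP[A At xA].
have KA : kernel k H A by move: At; rewrite inE => /andP[].
have c1 : #|A :&: (x |: K)| = #|A :&: K|.+1.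
  by rewrite setIUr (setIidPr _) ?sub1set // cardsU1 inE (negPf xK) andbF.
have le : #|A :&: (x |: K)| <= t by rewrite -(card_teams At) subset_leq_card // subsetIl.
have AK0 : #|A :&: K| = 0.
  by apply: Iset_lt; [exact: Iset_kernelI | rewrite -c1].
have := Iset_lt (Iset_kernelI KA KxK); rewrite c1 AK0.
by move/(_ t2).
Qed.

(** Two distinct kernels of size q(t-1) meet in a multiple of t points, fewer than
    q(t-1).  At a common point x of their spreads, adding x to both gives an
    intersection with one point more, whose size is not in I. *)
Lemma spread_disjoint K L : K != L -> [disjoint spread K & spread L].
Proof.
move=> KL; rewrite -setI_eq0; apply/eqP/setP => x; rewrite in_setI in_set0.
apply/negP => /andP[/mem_spread[KK KxK xK cK] /mem_spread[KL' KxL xL cL]].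
have lt : #|K :&: L| < q * (t - 1).
  rewrite ltn_neqAle -{2}cK subset_leq_card ?subsetIl // andbT.
  apply: contra KL => /eqP E; rewrite eqEcard cK cL leqnn andbT.
  by apply/setIidPl/eqP; rewrite eqEcard subsetIl cK E /=.
have tKL : t %| #|K :&: L|.
  by have := Iset_kernelI KK KL'; rewrite /Iset leqNgt lt orbF.
have := Iset_kernelI KxK KxL; rewrite -setUIr cardsU1 inE (negPf xK) /= add1n /Iset.
case/orP=> [|ge]; first by move/(dvdn_consecutive t2 tKL).
have E : #|K :&: L|.+1 = q * (t - 1) by apply/eqP; rewrite eqn_leq lt ge.
by apply: (dvdn_consecutive t2 tKL); rewrite E mulnAC dvdn_mull.
Qed.

Lemma card_star_bin K : #|star K| <= 'C(#|spread K|, q).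
Proof.
have inj : {in star K &, injective (fun e => e :\: K)}.
  move=> e f /mem_star[_ /and4P[Ke _ _ _]] /mem_star[_ /and4P[Kf _ _ _]] E.
  by rewrite -(setID e K) -(setID f K) E (setIidPr Ke) (setIidPr Kf).
rewrite -cards_draws -(card_in_imset inj).
apply: subset_leq_card; apply/subsetP => _ /imsetP[e es ->].
have [eH /and4P[Ke /eqP cK _ _]] := mem_star es.
rewrite inE (bigcup_sup e) //= cardsD (setIidPr Ke) Hk // k_eq cK mulnBr muln1.
by rewrite subKn // leq_pmulr.
Qed.

Lemma card_star_deg K : #|star K| <= maxdeg H.
Proof.
have [->|/set0Pn[e0 es]] := eqVneq (star K) set0; first by rewrite cards0.
have [_ /and4P[_ /eqP cK _ _]] := mem_star es.
have /card_gt0P[v vK] : 0 < #|K| by rewrite cK muln_gt0 q0 subn_gt0.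
apply: leq_trans (leq_bigmax v); apply: subset_leq_card.
apply/subsetP => e /mem_star[eH /and4P[Ke _ _ _]].
by rewrite inE eH (subsetP Ke).
Qed.

(** Each star has at most C(x,q) edges for a set of x points of its own, and at most
    C(m,q) edges; [bin_chord] makes these bounds additive. *)
Lemma card_focused m : maxdeg H <= 'C(m, q) ->
  m * #|focused| <= #|~: cover teams| * 'C(m, q).
Proof.
move=> Dm; have -> : #|focused| = \sum_(K : {set T}) #|star K|.
  rewrite -sum1_card (partition_big core xpredT) //=; apply: eq_bigr => K _.
  by rewrite -sum1_card; apply: eq_bigl => e; rewrite [in RHS]inE.
apply: leq_trans (_ : (\sum_(K : {set T}) #|spread K|) * 'C(m, q) <= _).
  rewrite big_distrr big_distrl /=; apply: leq_sum => K _.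
  by apply: bin_chord => //; rewrite ?card_star_bin // (leq_trans (card_star_deg K)).
rewrite leq_mul2r; apply/orP; right.
have -> : \sum_(K : {set T}) #|spread K| = #|\bigcup_(K : {set T}) spread K|.
  rewrite -sum1_card partition_disjoint_bigcup /=; last exact: spread_disjoint.
  by apply: eq_bigr => K _; rewrite sum1_card.
by apply: subset_leq_card; apply/bigcupsP => K _; apply: spread_outside.
Qed.

Lemma maxdeg_gt0 : 0 < #|H| -> 0 < maxdeg H.
Proof.
move=> /card_gt0P[e eH]; have /card_gt0P[v ve] : 0 < #|e| by rewrite Hk.
by apply: leq_trans (leq_bigmax v); apply/card_gt0P; exists e; rewrite inE eH.
Qed.

Lemma card_H : #|H| = #|inner| + #|H :\: inner|.
Proof.
rewrite -(cardsID inner); congr (_ + _); congr #|pred_of_set _|.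
by apply/setIidPr/subsetP => e; rewrite inE => /andP[].
Qed.

Lemma card_outer : #|H :\: inner| <= #|focused| + #|scattered|.
Proof.
apply: leq_trans (leq_card_setU _ _); apply: subset_leq_card; apply/subsetP => e.
by rewrite !inE => /andP[-> ->] /=; case: [exists K, _].
Qed.

Lemma outer_part_neq0 e : e \in H :\: inner -> e :&: ~: cover teams != set0.
Proof.
by rewrite in_setD inE -setDE setD_eq0 => /andP[+ eH]; rewrite eH.
Qed.

(** The outer part of an edge consists of a multiple of t points. *)
Lemma card_outer_part_ge e : e \in H :\: inner -> t <= #|e :&: ~: cover teams|.
Proof.
move=> eo; have eH : e \in H by move: eo; rewrite inE => /andP[].
have pos : 0 < #|e :&: ~: cover teams| by rewrite card_gt0 outer_part_neq0.
apply: dvdn_leq => //; have := dvdn_mull q (dvdnn t).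
by rewrite -(card_outer_part eH) dvdn_addl // dvdn_mull.
Qed.

(** An edge e with outer part O is O plus at most q-1 teams.  If there are q-1 of
    them then O has t points but is not a team, so e meets a bounded set of points
    that does not depend on e, the hitting set of [kernel_hitting_set]; this
    determines one team up to a bounded number of choices and leaves q-2. *)
Lemma card_outer_small :
  #|H :\: inner| <= 2 ^ #|~: cover teams| * ((k * k + k) * #|T|.+1 ^ (q - 2)).
Proof.
set Z := ~: cover teams.
have /fin_all_exists[X XP] : forall O : {set T}, exists X : {set T},
    ~~ kernel k H O -> [/\ #|X| <= k * k, [disjoint X & O]
    & forall e, e \in H -> O \subset e -> O != e -> ~~ [disjoint X & e]].
  move=> O; have [|nk] := boolP (kernel k H O); first by exists set0.
  by have [X XP] := kernel_hitting_set Hk nk; exists X.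
(* A point y in O is a dummy: it selects no team, for edges with at most
   q-2 teams. *)
pose Y O := (if kernel k H O then set0 else X O) :|: (if #|O| <= k then O else set0).
pose rebuild O y D := O :|: cover [set A in teams | ~~ [disjoint A & y |: D]].
pose small := [set D : {set T} | #|D| <= q - 2].
have sub : H :\: inner \subset
    \bigcup_(O in powerset Z) \bigcup_(y in Y O) (rebuild O y @: small).
  apply/subsetP => e eo; have eH : e \in H by move: eo; rewrite inE => /andP[].
  set O := e :&: Z; have OZ : O \subset Z by apply: subsetIr.
  apply/bigcupP; exists O; first by rewrite powersetE.
  have eE : e = O :|: cover (teams_of e).
    by rewrite cover_teams_of // /O /Z -setDE setUC setID.
  have Ok : #|O| <= k by rewrite -(Hk eH) subset_leq_card // subsetIl.
  (* D has a point in each team of Q, and y lies in the remaining team, if there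
     is one. *)
  have build y Q : y \in Y O -> Q \subset teams_of e -> #|Q| <= q - 2 ->
      (forall A, A \in teams -> ((A \in teams_of e) = (y \in A) || (A \in Q))) ->
      e \in \bigcup_(y in Y O) (rebuild O y @: small).
    move=> yY Qe Qq EQ; apply/bigcupP; exists y => //.
    have Qt : Q \subset teams := subset_trans Qe (teams_of_sub e).
    have [A /(subsetP Qt) At|D [DQ Dcov Dhit]] := @exists_reps _ Q.
      by rewrite -card_gt0 card_teams.
    apply/imsetP; exists D; first by rewrite inE (leq_trans DQ).
    rewrite /rebuild {1}eE; congr (_ :|: cover _); apply/setP => A.
    rewrite [RHS]inE; case At: (A \in teams) => /=; last by rewrite inE At.
    rewrite EQ //; apply/idP/idP => [/orP[yA|AQ]|].
    - by rewrite -setI_eq0; apply/set0Pn; exists y; rewrite !inE yA eqxx.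
    - by apply: contra (Dhit A AQ); apply: disjointWr; apply: subsetUr.
    rewrite -setI_eq0 => /set0Pn[x /setIP[xA /setU1P[<-|xD]]]; first by rewrite xA.
    have /bigcupP[B BQ xB] := subsetP Dcov x xD.
    by rewrite (trivIset_eq trivIset_teams At (subsetP Qt B BQ) xA xB) BQ orbT.
  have On0 : O != set0 := outer_part_neq0 eo.
  have := card_outer_part eH; rewrite -/Z -/O => cO.
  have cQ : #|teams_of e| < q.
    rewrite -(ltn_pmul2r t0) -cO -[ltnLHS]add0n ltn_add2r.
    by rewrite card_gt0.
  have outT y A : y \in Z -> A \in teams -> (y \in A) = false.
    by rewrite inE => yZ At; apply: contraNF yZ => yA; apply/bigcupP; exists A.
  have [le|gt] := leqP #|teams_of e| (q - 2).
    have /set0Pn[y yO] := On0; apply: (build y (teams_of e)) => //.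
      by rewrite inE Ok yO orbT.
    by move=> A At; rewrite outT // (subsetP OZ).
  have cQ' : #|teams_of e|.+1 = q by move: q2 cQ gt; clear; lia.
  have cO' : #|O| = t.
    by move: cO; rewrite -[in RHS]cQ' mulSn => /eqP; rewrite eqn_add2r => /eqP.
  have nker : ~~ kernel k H O.
    apply/negP => KO; have Ot : O \in teams by rewrite inE cO' eqxx.
    have /set0Pn[y yO] := On0.
    by have := outT y O (subsetP OZ y yO) Ot; rewrite yO.
  have [_ Xdis Xhit] := XP O nker.
  have := Xhit e eH (subsetIl _ _).
  have -> : O != e.
    apply: contraTneq q2 => Oe; rewrite -leqNgt -(leq_pmul2r t0) mul1n.
    by rewrite -k_eq -(Hk eH) -Oe cO'.
  move=> /(_ isT); rewrite -setI_eq0 => /set0Pn[y /setIP[yX ye]].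
  have yO : y \notin O by rewrite (disjointFr Xdis yX).
  have : y \in cover (teams_of e) by move: ye; rewrite {1}eE inE (negPf yO).
  move=> /bigcupP[A Ae yA]; have At := subsetP (teams_of_sub e) A Ae.
  apply: (build y (teams_of e :\ A)).
  - by rewrite inE (negPf nker) yX.
  - exact: subD1set.
  - by move: cQ'; rewrite (cardsD1 A (teams_of e)) Ae => <-; rewrite add1n subn2.
  move=> B Bt; rewrite in_setD1; have [->|BA] := eqVneq B A; first by rewrite yA Ae.
  suff -> : (y \in B) = false by [].
  by apply: contraNF BA => yB; rewrite (trivIset_eq trivIset_teams Bt At yB yA).
apply: leq_trans (subset_leq_card sub) _; rewrite -card_powerset.
apply: leq_card_bigcup => O _; apply: leq_trans (leq_card_bigcup (b := #|T|.+1 ^ (q - 2)) _) _.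
  by move=> y _; apply: leq_trans (leq_imset_card _ _) (card_small_sets T _).
rewrite leq_mul2r; apply/orP; right.
apply: leq_trans (leq_card_setU _ _) _; apply: leq_add.
  by case: ifPn => [_|nk]; [rewrite cards0 | have [] := XP O nk].
by case: ifP; rewrite ?cards0.
Qed.

End Structure.

(** * The maximum degree *)

Lemma degree_of_many_edges (T : finType) (r t : nat) (H : {set {set T}}) :
  0 < r -> 2 <= t -> classJ r t H ->
  order_bound (r * t) t (homogeneity_loss (r * t ^ 2))
    (r * t ^ 2 * (r * t ^ 2) + r * t ^ 2) <= #|T| ->
  'C(#|T| %/ t, r * t) < #|H| -> #|H| <= 3 * t * maxdeg H.
Proof.
move=> r0 t2 HJ le_n many; have t0 : 0 < t by apply: ltnW.
apply: (degree_of_counts _ _ _ le_n _ many (card_H r t H) (card_inner r0 t2 HJ)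
  (card_outer r t H) (card_scattered r0 t2 HJ) (card_outer_small r0 t2 HJ) _ _
  (card_focused r0 t2 HJ)) => //.
- by apply: leq_trans t2 _; rewrite leq_pmull.
- apply: leq_trans (_ : 2 ^ t.-1 <= _); first by rewrite -{1}(prednK t0) ltn_expl.
  by rewrite leq_exp2l // -!subn1 leq_sub2r // leq_pmull.
- rewrite -(card_cover_teams (trivIset_teams r0 t2 HJ) (@card_teams _ r t H)) //.
  by rewrite cardsC.
- move=> a_lt; apply/eqP; rewrite cards_eq0; apply/eqP/setP => e; rewrite [RHS]inE.
  apply/negP => /(card_outer_part_ge r0 t2 HJ) /(leq_trans a_lt).
  by rewrite ltnNge subset_leq_card // subsetIr.
- by apply: (maxdeg_gt0 r0 t2 HJ); apply: leq_ltn_trans many.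
Qed.

Theorem theorem1p1 (r t : nat) (hr : 1 <= r) (ht : 2 <= t) :
  (exists n0 : nat, forall (T : finType) (H : {set {set T}}),
     classJ r t H ->
     n0 <= #|T| ->
     'C(#|T| %/ t, r * t) + 1 <= #|H| ->
     (#|H|%:R / (3 * t%:R) <= (maxdeg H)%:R :> rat)%R)
  /\
  (forall (n : nat) (T : finType), r * t ^ 2 <= n -> #|T| = n ->
     (exists H0 : {set {set T}}, thick_clique r t H0) /\
     (forall H0 : {set {set T}}, thick_clique r t H0 ->
        [/\ classJ r t H0,
            #|H0| = 'C(n %/ t, r * t)
          & maxdeg H0 = 'C(n %/ t - 1, r * t - 1)])).
Proof.
split; last first.
  move=> n T le_n card_T; rewrite -card_T in le_n *; split.
    exact: thick_clique_exists.
  exact: thick_clique_spec.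
exists (order_bound (r * t) t (homogeneity_loss (r * t ^ 2))
  (r * t ^ 2 * (r * t ^ 2) + r * t ^ 2)) => T H HJ le_n.
rewrite addn1 => many; have t0 : 0 < t by apply: ltnW.
rewrite ler_pdivrMr -?natrM ?ltr0n ?muln_gt0 // ler_nat mulnC.
exact: degree_of_many_edges hr ht HJ le_n many.
Qed.
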